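(* Let $\theta$ be a real-valued function on $(0,1)$ and put $\rho_\theta(t)=te^{\theta(t)}$, $t\in(0,1)$. Assume that $\rho_\theta$ is continuous and nondecreasing and that there is a constant $C>0$ with $\rho_\theta(t)\le Ct$ for all $t\in(0,1)$. There exists a separated $\theta$-thick sequence $\{z_k\}\subset\mathbb{D}$ if and only if $$\int_0\frac{\rho_\theta(t)\,dt}{t^2}=\infty .$$
   Context: $\mathbb{D}=\{z\in\mathbb{C}:|z|<1\}$, and $H^\infty$ is the space of bounded holomorphic functions on $\mathbb{D}$. All sequences $\{z_k\}\subset\mathbb{D}$ are infinite and satisfy $|z_k|\to1$. A sequence $\{z_k\}$ is separated if $\inf_{n\neq k}\left|\frac{z_n-z_k}{1-\overline{z}_n z_k}\right|>0$. A sequence $\{z_k\}$ is $\theta$-thin if there exists $f\in H^\infty$, $f\not\equiv0$, with $\sum_k\rho_\theta(1-|z_k|)|f(z_k)|<\infty$ (if some $z_k=0$, the corresponding term is omitted). It is $\theta$-thick if it is not $\theta$-thin. $\int_0 g(t)\,dt=\infty$ means that $\int_0^{\varepsilon}g(t)\,dt=\infty$ for small $\varepsilon\in(0,1)$. *)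

(* Defs.v *)
From Stdlib Require Import Reals.
From Coquelicot Require Import Coquelicot.

Open Scope R_scope.

Definition in_disc (z : C) : Prop := Cmod z < 1.

(* [ex_derive] is taken over [C_AbsRing], i.e. it is complex differentiability;
   the values of [f] outside the disc are irrelevant. *)
Definition Hinfty (f : C -> C) : Prop :=
  (forall z : C, in_disc z -> @ex_derive C_AbsRing C_NormedModule f z) /\
  (exists M : R, forall z : C, in_disc z -> Cmod (f z) <= M).

Definition not_identically_zero (f : C -> C) : Prop :=
  exists z : C, in_disc z /\ f z <> RtoC 0.

(* Indexing by [nat] makes the sequence infinite. *)
Definition disc_seq (z : nat -> C) : Prop :=
  (forall k, in_disc (z k)) /\ is_lim_seq (fun k => Cmod (z k)) 1.

Definition pseudo_hyp_dist (a b : C) : R :=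
  Cmod ((a - b) / (RtoC 1 - Cconj a * b))%C.

Definition separated (z : nat -> C) : Prop :=
  Rbar_lt 0 (Glb_Rbar (fun d : R =>
    exists n k : nat, n <> k /\ d = pseudo_hyp_dist (z n) (z k))).

Definition rho (theta : R -> R) (t : R) : R := t * exp (theta t).

(* The terms are nonnegative, so convergence means that the sum is finite. *)
Definition thin (theta : R -> R) (z : nat -> C) : Prop :=
  exists f : C -> C, Hinfty f /\ not_identically_zero f /\
    ex_series (fun k : nat =>
      if Ceq_dec (z k) (RtoC 0) then 0
      else rho theta (1 - Cmod (z k)) * Cmod (f (z k))).

Definition thick (theta : R -> R) (z : nat -> C) : Prop := ~ thin theta z.

(* Meant for [g] continuous on (0,1): [RInt g d eps] is then a genuine Riemann
   integral for all 0 < d < eps < 1. *)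
Definition int_at_0_infinite (g : R -> R) : Prop :=
  exists eps0 : R, 0 < eps0 <= 1 /\
    forall eps : R, 0 < eps < eps0 ->
      filterlim (fun d : R => RInt g d eps) (at_right 0) (Rbar_locally p_infty).

(* Main.v *)
(* If the integral is finite, f = 1 witnesses thinness of every separated sequence:
   a separated sequence has O(2^n) points in the annulus 1 - |z| ~ 2^-n, so the series
   is dominated by sum 2^n rho(2^-n), which is comparable to the integral.

   If the integral is infinite, take the sequence whose n-th level consists of the 2^n
   points r_n w^j, w = exp(2 pi i / 2^n), r_n = 1 - 2^-(n+1).  For f = sum a_k z^k
   bounded and nonzero, choose m with a_m <> 0.  The m-th discrete Fourier coefficient of
   f over level n is a_m r_n^m + sum_{l >= 1} a_{m + l 2^n} r_n^{m + l 2^n}, and the last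
   sum tends to 0 because (a_k) is square summable and r_n^(2^n) stays away from 1.
   Hence the mean of |f| over level n is bounded below for large n, and
   sum_n 2^n rho(2^-(n+1)) = oo makes the series diverge.

   The Taylor expansion of a function that is only assumed complex differentiable
   comes from Goursat's subdivision argument, applied to the homotopy which
   contracts a circle to a point z inside it. *)
Require Import Defs.
From Stdlib Require Import Reals Lra Lia Psatz List Classical.
From Coquelicot Require Import Coquelicot.
Open Scope R_scope.

(** * Goursat's argument *)

(** A bounded [f] may be tiny at many points of a level, so no pointwise lower bound is available.
    Only the average of [|f|] can be controlled, by pairing [f] with one character [z ^ m] whose
    Taylor coefficient does not vanish. The aliased terms of this pairing need no decay rate:
    splitting each product by [A * B <= A ^ 2 / c + (c / 4) * B ^ 2] leaves a tail of squared
    coefficients and a geometric series. Square summability is itself read off from roots of unity,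
    since sufficiently many sample points turn Parseval into a finite identity.

    The relation [2 * 2 ^ n * dyadic n = 1] between the size of a level and its distance to the
    circle balances the lattice: the points are few enough to stay apart at the scale [1 - |z|], and
    many enough for [r ^ (2 * 2 ^ n) <= 1 / 2].

    On the analytic side the homotopy is exponential in its parameter, so the logarithmic derivative
    of [w - z] has the simple form [L ds + k dt]. Subdivision then takes place in the parameter
    square, never in the disc. *)

Section Descent.

Variable J : R -> R -> R -> R.

Definition in_unit_square (x y h : R) : Prop :=
  0 < h /\ 0 <= x /\ x + h <= 1 /\ 0 <= y /\ y + h <= 1.

(** The last quadrant is taken without a test: by subadditivity it must be heavy when the other
    three are not. Squares are represented by their lower left corners. *)
Definition heavy_quadrant (eta : R) (c : R * R) (h : R) : R * R :=
  let (x, y) := c in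
  if Rle_dec (eta * (h / 2) ^ 2) (J x y (h / 2)) then (x, y)
  else if Rle_dec (eta * (h / 2) ^ 2) (J (x + h / 2) y (h / 2)) then (x + h / 2, y)
  else if Rle_dec (eta * (h / 2) ^ 2) (J x (y + h / 2) (h / 2)) then (x, y + h / 2)
  else (x + h / 2, y + h / 2).

Fixpoint heavy_squares (eta : R) (n : nat) : R * R :=
  match n with
  | O => (0, 0)
  | S n => heavy_quadrant eta (heavy_squares eta n) ((/ 2) ^ n)
  end.

Lemma nested_intervals (x h : nat -> R) :
  (forall n, 0 <= h n) ->
  (forall n, x n <= x (S n)) -> (forall n, x (S n) + h (S n) <= x n + h n) ->
  exists p, forall n, x n <= p <= x n + h n.
Proof.
intros h0 xi xd.
assert (mi : forall n m, (n <= m)%nat -> x n <= x m).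
{ intros n m H; induction H; [lra|specialize (xi m); lra]. }
assert (md : forall n m, (n <= m)%nat -> x m + h m <= x n + h n).
{ intros n m H; induction H; [lra|specialize (xd m); lra]. }
assert (B : forall n m, x n <= x m + h m).
{ intros n m; destruct (Nat.le_ge_cases n m) as [H|H].
  - specialize (mi _ _ H); specialize (h0 m); lra.
  - specialize (md _ _ H); specialize (h0 n); lra. }
destruct (completeness (fun r => exists n, r = x n)) as [p [Hu Hl]].
- exists (x O + h O); intros r [n ->]; apply B.
- now exists (x O), O.
- exists p; intros n; split.
  + apply Hu; now exists n.
  + apply Hl; intros r [m ->]; apply B.
Qed.

(* Goursat's subdivision argument, for an arbitrary subadditive function of
   squares in place of the modulus of a contour integral. *)
Lemma subadditive_square_function_nonpos :
  (forall x y h, in_unit_square x y h ->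
     J x y h <= J x y (h / 2) + J (x + h / 2) y (h / 2)
              + J x (y + h / 2) (h / 2) + J (x + h / 2) (y + h / 2) (h / 2)) ->
  (forall p q, 0 <= p <= 1 -> 0 <= q <= 1 -> forall eps, 0 < eps ->
     exists delta, 0 < delta /\
       forall x y h, in_unit_square x y h -> h < delta ->
         x <= p <= x + h -> y <= q <= y + h -> J x y h <= eps * h ^ 2) ->
  J 0 0 1 <= 0.
Proof.
intros sub loc.
apply Rnot_lt_le; intros pos.
set (eta := J 0 0 1).
set (c := heavy_squares eta).
set (h := fun n : nat => (/ 2) ^ n).
assert (hp : forall n, 0 < h n) by (intros n; unfold h; apply pow_lt; lra).
assert (hS : forall n, h (S n) = h n / 2) by (intros n; unfold h; simpl; lra).
(* The density of [J] relative to area never drops below its initial value [eta]. *)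
assert (inv : forall n, in_unit_square (fst (c n)) (snd (c n)) (h n) /\
   eta * h n ^ 2 <= J (fst (c n)) (snd (c n)) (h n)).
{ induction n as [|n [U IH]].
  - unfold c, h, in_unit_square; simpl.
    repeat split; try lra.
    replace (eta * (1 * (1 * 1))) with eta by ring; unfold eta; lra.
  - specialize (sub _ _ _ U).
    rewrite hS. unfold c in *; simpl.
    destruct (heavy_squares eta n) as [x y]; simpl in *.
    fold (h n). unfold in_unit_square in *; specialize (hp n).
    destruct (Rle_dec _ _); simpl; [split; [lra|easy]|].
    destruct (Rle_dec _ _); simpl; [split; [lra|easy]|].
    destruct (Rle_dec _ _); simpl; [split; [lra|easy]|].
    split; [lra|nra]. }
assert (stepx : forall n, fst (c n) <= fst (c (S n)) /\
   fst (c (S n)) + h (S n) <= fst (c n) + h n).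
{ intros n; rewrite hS; unfold c; simpl; fold (h n); specialize (hp n).
  destruct (heavy_squares eta n) as [x y]; simpl.
  repeat destruct (Rle_dec _ _); simpl; lra. }
assert (stepy : forall n, snd (c n) <= snd (c (S n)) /\
   snd (c (S n)) + h (S n) <= snd (c n) + h n).
{ intros n; rewrite hS; unfold c; simpl; fold (h n); specialize (hp n).
  destruct (heavy_squares eta n) as [x y]; simpl.
  repeat destruct (Rle_dec _ _); simpl; lra. }
destruct (nested_intervals (fun n => fst (c n)) h) as [p Hp];
  [intros n; left; auto|intros n; apply stepx|intros n; apply stepx|].
destruct (nested_intervals (fun n => snd (c n)) h) as [q Hq];
  [intros n; left; auto|intros n; apply stepy|intros n; apply stepy|].
(* At the common point the local bound allows only half the density that the selected squares
   keep. *)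
destruct (loc p q) with (eps := eta / 2) as [d [dp Hd]].
- specialize (Hp O); simpl in Hp; unfold h in Hp; simpl in Hp; lra.
- specialize (Hq O); simpl in Hq; unfold h in Hq; simpl in Hq; lra.
- unfold eta; lra.
- destruct (pow_lt_1_zero (/ 2)) with (y := d) as [N HN]; [rewrite Rabs_right; lra|lra|].
  specialize (HN N (Nat.le_refl _)).
  destruct (inv N) as [U I].
  specialize (Hd _ _ _ U).
  rewrite Rabs_right in HN by (left; apply (hp N)).
  specialize (Hd HN (Hp N) (Hq N)).
  assert (0 < h N ^ 2) by (apply pow_lt, hp).
  assert (0 < eta * h N ^ 2) by (apply Rmult_lt_0_compat; auto).
  lra.
Qed.

End Descent.

Lemma differentiable_pt_lim_continuous_fst (f : R -> R -> R) (s t ls lt : R) :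
  differentiable_pt_lim f s t ls lt -> continuous (fun u => f u t) s.
Proof.
intros H.
apply (ex_derive_continuous (fun u => f u t)).
exists (ls * 1 + lt * 0).
apply is_derive_Reals.
apply (derivable_pt_lim_comp_2d f (fun u => u) (fun _ => t)); auto.
apply derivable_pt_lim_id. apply derivable_pt_lim_const.
Qed.

Lemma differentiable_pt_lim_continuous_snd (f : R -> R -> R) (s t ls lt : R) :
  differentiable_pt_lim f s t ls lt -> continuous (fun v => f s v) t.
Proof.
intros H.
apply (ex_derive_continuous (fun u => f s u)).
exists (ls * 0 + lt * 1).
apply is_derive_Reals.
apply (derivable_pt_lim_comp_2d f (fun u => s) (fun v => v)); auto.
apply derivable_pt_lim_const. apply derivable_pt_lim_id.
Qed.

Lemma RInt_near_const (f : R -> R) (a h D e : R) :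
  0 <= h -> ex_RInt f a (a + h) ->
  (forall t, a <= t <= a + h -> Rabs (f t - D) <= e) ->
  Rabs (RInt f a (a + h) - D * h) <= e * h.
Proof.
intros hp If H.
replace (RInt f a (a + h) - D * h) with (RInt (fun t => f t - D) a (a + h)).
- replace (e * h) with ((a + h - a) * e) by ring.
  apply abs_RInt_le_const; [lra| |exact H].
  apply (ex_RInt_minus f (fun _ => D)); [exact If|apply ex_RInt_const].
- rewrite (RInt_minus f (fun _ => D)); [|exact If|apply ex_RInt_const].
  rewrite RInt_const. unfold minus, plus, opp, scal; simpl; unfold mult; simpl. ring.
Qed.

(* The partial derivatives are not assumed continuous, so differentiating under the
   integral sign is not an option; subdivision takes its place. *)
Lemma green_square (P Q : R -> R -> R) :
  (forall s t, 0 <= s <= 1 -> 0 <= t <= 1 -> exists Ps D Qt,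
     differentiable_pt_lim P s t Ps D /\ differentiable_pt_lim Q s t D Qt) ->
  RInt (fun t => Q 1 t - Q 0 t) 0 1 = RInt (fun s => P s 1 - P s 0) 0 1.
Proof.
intros dPQ.
assert (dP : forall s t, 0 <= s <= 1 -> 0 <= t <= 1 ->
  exists Ps D, differentiable_pt_lim P s t Ps D).
{ intros s t Hs Ht; destruct (dPQ s t Hs Ht) as (a & d & b & H & _); now exists a, d. }
assert (dQ : forall s t, 0 <= s <= 1 -> 0 <= t <= 1 ->
  exists D Qt, differentiable_pt_lim Q s t D Qt).
{ intros s t Hs Ht; destruct (dPQ s t Hs Ht) as (a & d & b & _ & H); now exists d, b. }
assert (exQ : forall s s' a b, 0 <= s <= 1 -> 0 <= s' <= 1 -> 0 <= a -> a <= b -> b <= 1 ->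
   ex_RInt (fun t => Q s' t - Q s t) a b).
{ intros s s' a b Hs Hs' Ha Hab Hb. apply (@ex_RInt_continuous R_CompleteNormedModule).
  intros t; rewrite Rmin_left, Rmax_right by lra; intros Ht.
  apply (continuous_minus (fun t => Q s' t) (fun t => Q s t));
  [destruct (dQ s' t) as (? & ? & H)|destruct (dQ s t) as (? & ? & H)]; try lra;
  eapply differentiable_pt_lim_continuous_snd; exact H. }
assert (exP : forall t t' a b, 0 <= t <= 1 -> 0 <= t' <= 1 -> 0 <= a -> a <= b -> b <= 1 ->
   ex_RInt (fun s => P s t' - P s t) a b).
{ intros t t' a b Ht Ht' Ha Hab Hb. apply (@ex_RInt_continuous R_CompleteNormedModule).
  intros s; rewrite Rmin_left, Rmax_right by lra; intros Hs.
  apply (continuous_minus (fun s => P s t') (fun s => P s t));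
  [destruct (dP s t') as (? & ? & H)|destruct (dP s t) as (? & ? & H)]; try lra;
  eapply differentiable_pt_lim_continuous_fst; exact H. }
set (I := fun x y h => RInt (fun t => Q (x + h) t - Q x t) y (y + h)
                       - RInt (fun s => P s (y + h) - P s y) x (x + h)).
(* An edge difference telescopes through the midline, so the contributions of inner edges cancel.
   The statement is used for [Q] and, with the arguments exchanged, for [P]. *)
assert (spl : forall (F : R -> R -> R) (x y h : R),
  (forall s s' a b, 0 <= s <= 1 -> 0 <= s' <= 1 -> 0 <= a -> a <= b -> b <= 1 ->
   ex_RInt (fun t => F s' t - F s t) a b) ->
  in_unit_square x y h ->
  RInt (fun t => F (x + h) t - F x t) y (y + h) =
  RInt (fun t => F (x + h/2) t - F x t) y (y + h/2) +
  RInt (fun t => F (x + h/2) t - F x t) (y + h/2) (y + h) +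
  RInt (fun t => F (x + h) t - F (x + h/2) t) y (y + h/2) +
  RInt (fun t => F (x + h) t - F (x + h/2) t) (y + h/2) (y + h)).
{ intros F x y h ex (h0 & x0 & x1 & y0 & y1).
  assert (L : forall s s', 0 <= s <= 1 -> 0 <= s' <= 1 ->
    RInt (fun t => F s' t - F s t) y (y + h/2) + RInt (fun t => F s' t - F s t) (y + h/2) (y+h)
    = RInt (fun t => F s' t - F s t) y (y + h)).
  { intros s s' Hs Hs'.
    apply (RInt_Chasles (fun t => F s' t - F s t)); apply ex; lra. }
  rewrite L by lra. rewrite Rplus_assoc, L by lra.
  rewrite <- (RInt_plus (fun t => F (x + h/2) t - F x t) (fun t => F (x + h) t - F (x + h/2) t))
    by (apply ex; lra).
  apply RInt_ext; intros t _; unfold plus; simpl; ring. }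
assert (Z : Rabs (I 0 0 1) <= 0).
{ apply (subadditive_square_function_nonpos (fun x y h => Rabs (I x y h))).
  - intros x y h U.
    replace (I x y h) with (I x y (h/2) + I (x + h/2) y (h/2) + I x (y + h/2) (h/2)
      + I (x + h/2) (y + h/2) (h/2)).
    + repeat (eapply Rle_trans; [apply Rabs_triang|apply Rplus_le_compat; try lra]).
    + unfold I.
      rewrite (spl Q x y h exQ U).
      rewrite (spl (fun t s => P s t) y x h).
      * replace (x + h / 2 + h / 2) with (x + h) by field.
        replace (y + h / 2 + h / 2) with (y + h) by field.
        ring.
      * exact exP.
      * unfold in_unit_square in *; lra.
  - intros p q Hp Hq eps He.
    (* To first order both edge integrals equal [D * h * h], with the same mixed coefficient [D],
       and cancel. Each collects the error of two opposite edges, so the total is at most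
       [eps / 2 * h ^ 2]. *)
    assert (e8 : 0 < eps / 8) by lra.
    destruct (dPQ p q Hp Hq) as (Ps & D & Qt & H1 & H2).
    specialize (H1 (mkposreal _ e8)). specialize (H2 (mkposreal _ e8)).
    destruct H1 as [d1 H1], H2 as [d2 H2].
    simpl in H1, H2.
    exists (Rmin d1 d2); split; [apply Rmin_pos; apply cond_pos|].
    intros x y h (h0 & x0 & x1 & y0 & y1) hd Hxp Hyq.
    assert (hd1 : h < d1) by (eapply Rlt_le_trans; [exact hd|apply Rmin_l]).
    assert (hd2 : h < d2) by (eapply Rlt_le_trans; [exact hd|apply Rmin_r]).
    assert (ab : forall u c w, c <= u <= c + h -> c <= w <= c + h -> Rabs (u - w) <= h)
      by (intros; apply Rabs_le; lra).
    assert (K1 : forall s t, x <= s <= x + h -> y <= t <= y + h ->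
      Rabs (P s t - P p q - (Ps * (s - p) + D * (t - q))) <= eps / 8 * h).
    { intros s t Hs Ht.
      assert (A := ab s x p Hs Hxp). assert (B := ab t y q Ht Hyq).
      eapply Rle_trans; [apply H1; lra|].
      apply Rmult_le_compat_l; [lra|]. apply Rmax_lub; assumption. }
    assert (K2 : forall s t, x <= s <= x + h -> y <= t <= y + h ->
      Rabs (Q s t - Q p q - (D * (s - p) + Qt * (t - q))) <= eps / 8 * h).
    { intros s t Hs Ht.
      assert (A := ab s x p Hs Hxp). assert (B := ab t y q Ht Hyq).
      eapply Rle_trans; [apply H2; lra|].
      apply Rmult_le_compat_l; [lra|]. apply Rmax_lub; assumption. }
    assert (IQ : Rabs (RInt (fun t => Q (x + h) t - Q x t) y (y + h) - (D * h) * h)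
                 <= (eps / 4 * h) * h).
    { apply RInt_near_const; [lra|apply exQ; lra|].
      intros t Ht.
      assert (A := K2 (x + h) t ltac:(lra) Ht). assert (B := K2 x t ltac:(lra) Ht).
      apply Rabs_le_between in A. apply Rabs_le_between in B.
      apply Rabs_le_between; lra. }
    assert (IP : Rabs (RInt (fun s => P s (y + h) - P s y) x (x + h) - (D * h) * h)
                 <= (eps / 4 * h) * h).
    { apply RInt_near_const; [lra|apply exP; lra|].
      intros t Ht.
      assert (A := K1 t (y + h) Ht ltac:(lra)). assert (B := K1 t y Ht ltac:(lra)).
      apply Rabs_le_between in A. apply Rabs_le_between in B.
      apply Rabs_le_between; lra. }
    unfold I.
    apply Rabs_le_between in IQ. apply Rabs_le_between in IP.
    assert (0 <= eps * h ^ 2) by (apply Rmult_le_pos; [lra|apply pow2_ge_0]).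
    apply Rabs_le_between. simpl in *. lra. }
assert (E : I 0 0 1 = 0).
{ destruct (Req_dec (I 0 0 1) 0) as [|N]; [easy|].
  apply Rabs_pos_lt in N; lra. }
unfold I in E. rewrite Rplus_0_l in E. lra.
Qed.

(** * Complex differentiability and integration along loops *)

Definition complex_derivative (f : C -> C) (z l : C) : Prop :=
  forall eps, 0 < eps -> exists delta, 0 < delta /\
    forall w : C, Cmod (w - z) < delta ->
      Cmod (f w - f z - l * (w - z)) <= eps * Cmod (w - z).

Lemma ex_derive_complex_derivative (f : C -> C) (z : C) :
  @ex_derive C_AbsRing C_NormedModule f z -> exists l, complex_derivative f z l.
Proof.
intros [l [_ H]]; exists l; intros eps He.
specialize (H z (fun P HP => HP) (mkposreal _ He)).
destruct H as [d Hd]; exists d; split; [apply cond_pos|].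
intros w Hw.
specialize (Hd w Hw).
replace (f w - f z - l * (w - z))%C with (f w - f z - (w - z) * l)%C by ring.
exact Hd.
Qed.

Lemma complex_derivative_scal (f : C -> C) (z l c : C) :
  complex_derivative f z l -> complex_derivative (fun w => c * f w)%C z (c * l)%C.
Proof.
intros H eps He.
assert (Hc : 0 < Cmod c + 1) by (pose proof (Cmod_ge_0 c); lra).
destruct (H (eps / (Cmod c + 1))) as [d [dp Hd]].
- apply Rdiv_lt_0_compat; lra.
- exists d; split; [easy|]; intros w Hw.
  replace (c * f w - c * f z - c * l * (w - z))%C with (c * (f w - f z - l * (w - z)))%C by ring.
  rewrite Cmod_mult.
  specialize (Hd w Hw).
  pose proof (Cmod_ge_0 c). pose proof (Cmod_ge_0 (w - z)).
  eapply Rle_trans; [apply Rmult_le_compat_l; [easy|exact Hd]|].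
  replace (Cmod c * (eps / (Cmod c + 1) * Cmod (w - z)))
    with (Cmod c / (Cmod c + 1) * (eps * Cmod (w - z))) by (field; lra).
  rewrite <- (Rmult_1_l (eps * Cmod (w - z))) at 2.
  apply Rmult_le_compat_r; [apply Rmult_le_pos; lra|].
  apply Rmult_le_reg_r with (Cmod c + 1); [lra|].
  unfold Rdiv; rewrite Rmult_assoc, Rinv_l by lra; lra.
Qed.

Lemma complex_derivative_continuous (f : C -> C) (z l : C) :
  complex_derivative f z l ->
  forall eps, 0 < eps -> exists delta, 0 < delta /\
    forall w : C, Cmod (w - z) < delta -> Cmod (f w - f z) <= eps.
Proof.
intros H eps He.
destruct (H 1 Rlt_0_1) as [d [dp Hd]].
assert (Hl := Cmod_ge_0 l).
exists (Rmin d (eps / (Cmod l + 1))); split.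
- apply Rmin_pos; [easy|apply Rdiv_lt_0_compat; lra].
- intros w Hw.
  specialize (Hd w (Rlt_le_trans _ _ _ Hw (Rmin_l _ _))).
  assert (Hw2 := Rlt_le_trans _ _ _ Hw (Rmin_r _ _)).
  replace (f w - f z)%C with ((f w - f z - l * (w - z)) + l * (w - z))%C by ring.
  eapply Rle_trans; [apply Cmod_triangle|]. rewrite Cmod_mult.
  assert (E : eps = (Cmod l + 1) * (eps / (Cmod l + 1))) by (field; lra).
  rewrite E. pose proof (Cmod_ge_0 (w - z)). nra.
Qed.

Lemma im_le_Cmod (c : C) : Rabs (Im c) <= Cmod c.
Proof. eapply Rle_trans; [apply Rmax_r|apply Rmax_Cmod]. Qed.

Lemma Cmod_le_re_im (c : C) : Cmod c <= Rabs (Re c) + Rabs (Im c).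
Proof.
apply Rsqr_incr_0_var.
- assert (H := Cmod2_alt c). unfold Rsqr.
  rewrite <- (pow2_abs (Re c)), <- (pow2_abs (Im c)) in H.
  pose proof (Rabs_pos (Re c)); pose proof (Rabs_pos (Im c)). simpl in H; nra.
- pose proof (Rabs_pos (Re c)); pose proof (Rabs_pos (Im c)); lra.
Qed.

Lemma complex_derivative_cauchy_riemann (f : C -> C) (x y : R) (l : C) :
  complex_derivative f (x, y) l ->
  differentiable_pt_lim (fun a b => Re (f (a, b))) x y (Re l) (- Im l) /\
  differentiable_pt_lim (fun a b => Im (f (a, b))) x y (Im l) (Re l).
Proof.
intros H.
assert (K : forall eps : posreal, locally_2d (fun a b =>
   Cmod (f (a, b) - f (x, y) - l * ((a, b) - (x, y)))
     <= eps * Rmax (Rabs (a - x)) (Rabs (b - y))) x y).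
{ intros eps.
  (* Halving both [eps] and [d] pays for the factor 2 between the modulus and the maximum of the
     coordinates. *)
  destruct (H (eps / 2)) as [d [dp Hd]]; [apply Rdiv_lt_0_compat; [apply cond_pos|lra]|].
  assert (d2 : 0 < d / 2) by lra.
  exists (mkposreal _ d2); simpl; intros a b Ha Hb.
  assert (B : Cmod ((a, b) - (x, y))%C <= 2 * Rmax (Rabs (a - x)) (Rabs (b - y))).
  { eapply Rle_trans; [apply Cmod_le_re_im|]; simpl. fold (a - x) (b - y).
    pose proof (Rmax_l (Rabs (a - x)) (Rabs (b - y))).
    pose proof (Rmax_r (Rabs (a - x)) (Rabs (b - y))). lra. }
  eapply Rle_trans; [apply Hd|].
  - eapply Rle_lt_trans; [apply B|].
    assert (Rmax (Rabs (a - x)) (Rabs (b - y)) < d / 2) by (apply Rmax_lub_lt; easy). lra.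
  - replace (eps * Rmax (Rabs (a - x)) (Rabs (b - y)))
      with (eps / 2 * (2 * Rmax (Rabs (a - x)) (Rabs (b - y)))) by field.
    apply Rmult_le_compat_l; [|exact B].
    pose proof (cond_pos eps); lra. }
split; intros eps; destruct (K eps) as [d Hd]; exists d; intros a b Ha Hb;
  (eapply Rle_trans; [|apply (Hd a b Ha Hb)]).
- eapply Rle_trans; [|apply re_le_Cmod]. apply Req_le; f_equal; unfold Re, Im; simpl; ring.
- eapply Rle_trans; [|apply im_le_Cmod]. apply Req_le; f_equal; unfold Re, Im; simpl; ring.
Qed.

Lemma differentiable_pt_lim_mult_add (c x y : R) :
  differentiable_pt_lim (fun a b => c + a * b) x y y x.
Proof.
intros eps; exists eps; intros a b Ha Hb.
replace (c + a * b - (c + x * y) - (y * (a - x) + x * (b - y)))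
  with ((a - x) * (b - y)) by ring.
rewrite Rabs_mult.
apply Rmult_le_compat; try apply Rabs_pos; [lra|apply Rmax_r].
Qed.

Lemma differentiable_pt_lim_minus2 (x y : R) :
  differentiable_pt_lim (fun a b => a - b) x y 1 (-1).
Proof.
intros eps; exists eps; intros a b Ha Hb.
replace (a - b - (x - y) - (1 * (a - x) + -1 * (b - y))) with 0 by ring.
rewrite Rabs_R0. apply Rmult_le_pos; [left; apply cond_pos|].
eapply Rle_trans; [apply Rabs_pos|apply Rmax_l].
Qed.

(** Derivability stands in for continuity: it passes through arithmetic and through composition with
    [f], and it guarantees that the integrals exist. *)
Definition path_derivable (g : R -> C) (t : R) : Prop :=
  ex_derive (fun t => Re (g t)) t /\ ex_derive (fun t => Im (g t)) t.

Lemma path_derivable_const (c : C) (t : R) : path_derivable (fun _ => c) t.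
Proof. split; apply ex_derive_const. Qed.

Lemma path_derivable_plus (g h : R -> C) (t : R) :
  path_derivable g t -> path_derivable h t -> path_derivable (fun t => g t + h t)%C t.
Proof.
intros [H1 H2] [H3 H4]; split; simpl.
- apply (ex_derive_plus (fun t => Re (g t)) (fun t => Re (h t))); easy.
- apply (ex_derive_plus (fun t => Im (g t)) (fun t => Im (h t))); easy.
Qed.

Lemma path_derivable_mult (g h : R -> C) (t : R) :
  path_derivable g t -> path_derivable h t -> path_derivable (fun t => g t * h t)%C t.
Proof.
intros [H1 H2] [H3 H4]; split; simpl;
  [apply (ex_derive_minus (V := R_NormedModule)) | apply (ex_derive_plus (V := R_NormedModule))];
  now apply ex_derive_mult.
Qed.

Lemma path_derivable_minus (g h : R -> C) (t : R) :
  path_derivable g t -> path_derivable h t -> path_derivable (fun t => g t - h t)%C t.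
Proof.
intros [H1 H2] [H3 H4]; split;
  now apply (ex_derive_minus (V := R_NormedModule)).
Qed.

Lemma path_derivable_inv (g : R -> C) (t : R) :
  path_derivable g t -> g t <> 0%C -> path_derivable (fun t => / g t)%C t.
Proof.
intros [H1 H2] H0.
assert (N : Re (g t) ^ 2 + Im (g t) ^ 2 <> 0).
{ rewrite <- Cmod2_alt. apply pow_nonzero.
  now intros E; apply H0, Cmod_eq_0. }
assert (D : ex_derive (fun t => Re (g t) ^ 2 + Im (g t) ^ 2) t)
  by (apply (ex_derive_plus (V := R_NormedModule)); now apply ex_derive_pow).
split; [apply (ex_derive_div (fun t => Re (g t)))
       |apply (ex_derive_div (fun t => - Im (g t)))]; try easy.
now apply (ex_derive_opp (V := R_NormedModule)).
Qed.

Lemma path_derivable_pow (g : R -> C) (t : R) (n : nat) :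
  path_derivable g t -> path_derivable (fun t => g t ^ n)%C t.
Proof.
intros H; induction n as [|n IH]; simpl.
- apply path_derivable_const.
- now apply path_derivable_mult.
Qed.

Lemma path_derivable_comp (f : C -> C) (g : R -> C) (t : R) (l : C) :
  complex_derivative f (g t) l -> path_derivable g t -> path_derivable (fun t => f (g t)) t.
Proof.
intros Hf [[l1 H1] [l2 H2]].
assert (Hf' : complex_derivative f (Re (g t), Im (g t)) l)
  by (unfold Re, Im; now rewrite <- surjective_pairing).
apply complex_derivative_cauchy_riemann in Hf' as [A B].
apply is_derive_Reals in H1, H2.
split; eexists; apply is_derive_Reals.
- eapply derivable_pt_lim_ext;
    [|exact (derivable_pt_lim_comp_2d _ _ _ _ _ _ _ _ A H1 H2)].
  intros y; simpl; unfold Re, Im; now rewrite <- surjective_pairing.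
- eapply derivable_pt_lim_ext;
    [|exact (derivable_pt_lim_comp_2d _ _ _ _ _ _ _ _ B H1 H2)].
  intros y; simpl; unfold Re, Im; now rewrite <- surjective_pairing.
Qed.

Definition path_derivable01 (g : R -> C) : Prop :=
  forall t, 0 <= t <= 1 -> path_derivable g t.

Definition CInt (g : R -> C) : C :=
  (RInt (fun t => Re (g t)) 0 1, RInt (fun t => Im (g t)) 0 1).

Lemma path_derivable01_ex_RInt (g : R -> C) : path_derivable01 g ->
  ex_RInt (fun t => Re (g t)) 0 1 /\ ex_RInt (fun t => Im (g t)) 0 1.
Proof.
intros H; split; apply (@ex_RInt_continuous R_CompleteNormedModule);
  intros t; rewrite Rmin_left, Rmax_right by lra; intros Ht;
  apply (ex_derive_continuous (K := R_AbsRing) (V := R_NormedModule)); now apply H.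
Qed.

Lemma CInt_ext (g h : R -> C) :
  (forall t, 0 <= t <= 1 -> g t = h t) -> CInt g = CInt h.
Proof.
intros H; unfold CInt; f_equal; apply RInt_ext; intros t;
  rewrite Rmin_left, Rmax_right by lra; intros Ht; rewrite H; trivial; lra.
Qed.

Lemma CInt_plus (g h : R -> C) : path_derivable01 g -> path_derivable01 h ->
  CInt (fun t => g t + h t)%C = (CInt g + CInt h)%C.
Proof.
intros Hg Hh.
destruct (path_derivable01_ex_RInt g Hg) as [g1 g2].
destruct (path_derivable01_ex_RInt h Hh) as [h1 h2].
unfold CInt, Cplus; simpl; f_equal; now apply (@RInt_plus R_CompleteNormedModule).
Qed.

Lemma RInt_ext_R (f g : R -> R) (a b : R) :
  (forall x, f x = g x) -> RInt f a b = RInt g a b.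
Proof. now intros H; apply (RInt_ext f g). Qed.

Lemma CInt_scal (c : C) (g : R -> C) : path_derivable01 g ->
  CInt (fun t => c * g t)%C = (c * CInt g)%C.
Proof.
intros Hg.
destruct (path_derivable01_ex_RInt g Hg) as [g1 g2].
assert (L : forall (a b : R) (u v : R -> R), ex_RInt u 0 1 -> ex_RInt v 0 1 ->
   RInt (fun t => a * u t + b * v t) 0 1 = a * RInt u 0 1 + b * RInt v 0 1).
{ intros a b u v Hu Hv.
  rewrite (RInt_plus (fun t => a * u t) (fun t => b * v t))
    by (apply (ex_RInt_scal (V := R_NormedModule)); easy).
  rewrite (RInt_scal u), (RInt_scal v) by easy. reflexivity. }
unfold CInt, Cmult; simpl; apply (f_equal2 (@pair R R)).
- rewrite (RInt_ext_R _ (fun t => fst c * Re (g t) + (- snd c) * Im (g t)))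
    by (intros; unfold Re, Im; simpl; ring).
  rewrite L by easy; ring.
- rewrite (RInt_ext_R _ (fun t => fst c * Im (g t) + snd c * Re (g t)))
    by (intros; unfold Re, Im; simpl; ring).
  rewrite L by easy; ring.
Qed.

(** The factor 2 comes from bounding the real and imaginary parts separately; the later estimates
    can afford it. *)
Lemma CInt_bound (g : R -> C) (B : R) : path_derivable01 g ->
  (forall t, 0 <= t <= 1 -> Cmod (g t) <= B) -> Cmod (CInt g) <= 2 * B.
Proof.
intros Hg HB.
destruct (path_derivable01_ex_RInt g Hg) as [g1 g2].
eapply Rle_trans; [apply Cmod_le_re_im|]; simpl.
assert (A1 : Rabs (RInt (fun t => Re (g t)) 0 1) <= (1 - 0) * B).
{ apply abs_RInt_le_const; [lra|easy|].
  intros t Ht; eapply Rle_trans; [apply re_le_Cmod|auto]. }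
assert (A2 : Rabs (RInt (fun t => Im (g t)) 0 1) <= (1 - 0) * B).
{ apply abs_RInt_le_const; [lra|easy|].
  intros t Ht; eapply Rle_trans; [apply im_le_Cmod|auto]. }
lra.
Qed.

(* The homotopy [z + exp (L (s - 1)) u t] contracts the loop [z + u] towards [z];
   [k] is the logarithmic derivative of [u], so [P ds + Q dt] is the real part of
   the pullback of [f w dw / (w - z)]. *)
Lemma contracted_loop_integral (f : C -> C) (z : C) (u k : R -> C) (L : R) :
  (forall s t, 0 <= s <= 1 -> 0 <= t <= 1 ->
     exists l, complex_derivative f (z + exp (L * (s - 1)) * u t)%C l) ->
  (forall t, 0 <= t <= 1 -> is_derive (fun t => Re (u t)) t (Re (k t * u t)%C) /\
                            is_derive (fun t => Im (u t)) t (Im (k t * u t)%C)) ->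
  path_derivable01 k -> u 0 = u 1 ->
  RInt (fun t => Re (f (z + u t) * k t)%C - Re (f (z + exp (- L) * u t) * k t)%C) 0 1 = 0.
Proof.
intros Hf Hu Hk u01.
set (g := fun s => exp (L * (s - 1))).
set (X := fun s t => Re z + g s * Re (u t)).
set (Y := fun s t => Im z + g s * Im (u t)).
assert (HXY : forall s t, (X s t, Y s t) = (z + g s * u t)%C).
{ intros s t; unfold X, Y, Cplus, Cmult; simpl; unfold Re, Im; f_equal; ring. }
assert (dg : forall s, derivable_pt_lim g s (L * g s)).
{ intros s; apply is_derive_Reals; unfold g; auto_derive; [easy|unfold Rminus; ring]. }
assert (dX : forall s t, 0 <= t <= 1 ->
  differentiable_pt_lim X s t (L * g s * Re (u t)) (g s * Re (k t * u t)%C)).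
{ intros s t Ht.
  replace (L * g s * Re (u t)) with (Re (u t) * (L * g s) + g s * 0) by ring.
  replace (g s * Re (k t * u t)%C) with (Re (u t) * 0 + g s * Re (k t * u t)%C) by ring.
  apply (differentiable_pt_lim_comp (fun a b => Re z + a * b) (fun s _ => g s) (fun _ t => Re (u t))).
  - apply differentiable_pt_lim_mult_add.
  - apply differentiable_pt_lim_proj1_0, dg.
  - intros eps. destruct (differentiable_pt_lim_proj1_0 (fun t => Re (u t)) t s (Re (k t * u t)%C)) with eps as [d Hd].
    + now apply is_derive_Reals, Hu.
    + exists d; intros a b Ha Hb. rewrite Rmax_comm.
      eapply Rle_trans; [|apply (Hd b a Hb Ha)]. apply Req_le; f_equal; ring. }
assert (dY : forall s t, 0 <= t <= 1 ->
  differentiable_pt_lim Y s t (L * g s * Im (u t)) (g s * Im (k t * u t)%C)).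
{ intros s t Ht.
  replace (L * g s * Im (u t)) with (Im (u t) * (L * g s) + g s * 0) by ring.
  replace (g s * Im (k t * u t)%C) with (Im (u t) * 0 + g s * Im (k t * u t)%C) by ring.
  apply (differentiable_pt_lim_comp (fun a b => Im z + a * b) (fun s _ => g s) (fun _ t => Im (u t))).
  - apply differentiable_pt_lim_mult_add.
  - apply differentiable_pt_lim_proj1_0, dg.
  - intros eps. destruct (differentiable_pt_lim_proj1_0 (fun t => Im (u t)) t s (Im (k t * u t)%C)) with eps as [d Hd].
    + now apply is_derive_Reals, Hu.
    + exists d; intros a b Ha Hb. rewrite Rmax_comm.
      eapply Rle_trans; [|apply (Hd b a Hb Ha)]. apply Req_le; f_equal; ring. }
set (U := fun s t => Re (f (X s t, Y s t))).
set (V := fun s t => Im (f (X s t, Y s t))).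
assert (dk : forall (w : R -> R) s t, ex_derive w t ->
  exists d, differentiable_pt_lim (fun _ t => w t) s t 0 d).
{ intros w s t [d Hd]; exists d; intros eps.
  apply is_derive_Reals in Hd.
  destruct (differentiable_pt_lim_proj1_0 w t s d Hd eps) as [e He].
  exists e; intros a b Ha Hb. rewrite Rmax_comm.
  eapply Rle_trans; [|apply (He b a Hb Ha)]. apply Req_le; f_equal; ring. }
assert (G : RInt (fun t => (U 1 t * Re (k t) - V 1 t * Im (k t))
                  - (U 0 t * Re (k t) - V 0 t * Im (k t))) 0 1
            = RInt (fun s => L * U s 1 - L * U s 0) 0 1).
{ apply (green_square (fun s t => L * U s t) (fun s t => U s t * Re (k t) - V s t * Im (k t))).
  intros s t Hs Ht.
  destruct (Hf s t Hs Ht) as [l Hl].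
  fold (g s) in Hl. rewrite <- HXY in Hl.
  apply complex_derivative_cauchy_riemann in Hl as [CR1 CR2].
  assert (dU := differentiable_pt_lim_comp _ X Y s t _ _ _ _ _ _ CR1 (dX s t Ht) (dY s t Ht)).
  assert (dV := differentiable_pt_lim_comp _ X Y s t _ _ _ _ _ _ CR2 (dX s t Ht) (dY s t Ht)).
  fold U in dU; fold V in dV.
  destruct (Hk t Ht) as [K1 K2].
  destruct (dk _ s t K1) as [d1 D1]. destruct (dk _ s t K2) as [d2 D2].
  assert (A0 := differentiable_pt_lim_comp (fun a b => 0 + a * b) (fun _ _ => L) U s t _ _ _ _ _ _
    (differentiable_pt_lim_mult_add 0 _ _)
    (differentiable_pt_lim_proj1_0 (fun _ => L) s t 0 (derivable_pt_lim_const L s)) dU).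
  assert (A1 := differentiable_pt_lim_comp (fun a b => 0 + a * b) U _ s t _ _ _ _ _ _
    (differentiable_pt_lim_mult_add 0 _ _) dU D1).
  assert (A2 := differentiable_pt_lim_comp (fun a b => 0 + a * b) V _ s t _ _ _ _ _ _
    (differentiable_pt_lim_mult_add 0 _ _) dV D2).
  assert (A := differentiable_pt_lim_comp (fun a b => a - b) _ _ s t _ _ _ _ _ _
    (differentiable_pt_lim_minus2 _ _) A1 A2).
  do 3 eexists; split.
  - eapply differentiable_pt_lim_ext; [|exact A0].
    exists (mkposreal _ Rlt_0_1); intros; ring.
  (* The [t]-partial of [P] has fixed the mixed coefficient. By Cauchy-Riemann the [s]-partial of
     [Q] is the same expression up to [ring]: both are the real part of [L * f' * g * k * u]. *)
  - eapply differentiable_pt_lim_ext.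
    2: match type of A with differentiable_pt_lim _ _ _ ?a _ =>
         match goal with |- differentiable_pt_lim _ _ _ ?b _ => replace b with a; [exact A|] end end;
       unfold Re, Im; simpl; ring.
    exists (mkposreal _ Rlt_0_1); intros; ring. }
(* The loop is closed, so the edges [t = 0] and [t = 1] of the parameter square have the same
   image. *)
rewrite (RInt_ext_R (fun s => L * U s 1 - L * U s 0) (fun _ => 0)) in G.
2: { intros s. unfold U, X, Y; rewrite u01; ring. }
rewrite (RInt_const (V := R_CompleteNormedModule) 0 1 0) in G.
etransitivity; [|etransitivity; [exact G|exact (Rmult_0_r (1 - 0))]].
apply RInt_ext_R; intros t.
unfold U, V; rewrite !HXY.
replace (g 1) with 1 by (unfold g; rewrite Rminus_diag, Rmult_0_r, exp_0; easy).
replace (g 0) with (exp (- L)) by (unfold g; f_equal; ring).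
rewrite Cmult_1_l. simpl; unfold Re, Im; ring.
Qed.

(** * The Cauchy formula on a circle *)

Definition expi (t : R) : C := (cos (2 * PI * t), sin (2 * PI * t)).

Lemma expi_add (s t : R) : expi (s + t) = (expi s * expi t)%C.
Proof.
unfold expi, Cmult; simpl.
rewrite Rmult_plus_distr_l, cos_plus, sin_plus. f_equal; ring.
Qed.

Lemma expi_0 : expi 0 = 1%C.
Proof. unfold expi; now rewrite Rmult_0_r, cos_0, sin_0. Qed.

Lemma expi_1 : expi 1 = 1%C.
Proof. unfold expi; now rewrite Rmult_1_r, cos_2PI, sin_2PI. Qed.

Lemma expi_pow (t : R) (n : nat) : expi (INR n * t) = (expi t ^ n)%C.
Proof.
induction n as [|n IH].
- simpl; now rewrite Rmult_0_l, expi_0.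
- rewrite S_INR, Cpow_S, <- IH, <- expi_add. f_equal; ring.
Qed.

Lemma expi_INR (n : nat) : expi (INR n) = 1%C.
Proof. rewrite <- (Rmult_1_r (INR n)), expi_pow, expi_1. apply Cpow_1_l. Qed.

Lemma Cmod_expi (t : R) : Cmod (expi t) = 1.
Proof.
unfold Cmod, expi; simpl. rewrite !Rmult_1_r, Rplus_comm.
change (sqrt (Rsqr (sin (2 * PI * t)) + Rsqr (cos (2 * PI * t))) = 1).
now rewrite sin2_cos2, sqrt_1.
Qed.

Lemma expi_neq_0 (t : R) : expi t <> 0%C.
Proof. apply Cmod_gt_0. rewrite Cmod_expi; lra. Qed.

Lemma expi_opp (t : R) : expi (- t) = Cconj (expi t).
Proof.
unfold expi, Cconj; simpl.
now rewrite <- Ropp_mult_distr_r, cos_neg, sin_neg.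
Qed.

Lemma expi_inv (t : R) : expi (- t) = (/ expi t)%C.
Proof.
rewrite <- (Cmult_1_r (expi (- t))), <- (Cinv_r (expi t)) by apply expi_neq_0.
rewrite Cmult_assoc, <- expi_add, Rplus_opp_l, expi_0. apply Cmult_1_l.
Qed.

Lemma is_derive_expi (t : R) :
  is_derive (fun t => Re (expi t)) t (Re (2 * PI * Ci * expi t)%C) /\
  is_derive (fun t => Im (expi t)) t (Im (2 * PI * Ci * expi t)%C).
Proof.
unfold expi, Re, Im; simpl; split; auto_derive; try easy; ring.
Qed.

Lemma path_derivable_expi (t : R) : path_derivable expi t.
Proof. destruct (is_derive_expi t); split; eexists; eassumption. Qed.

Lemma path_derivable_circle (r : R) (t : R) : path_derivable (fun t => r * expi t)%C t.
Proof. apply path_derivable_mult; [apply path_derivable_const|apply path_derivable_expi]. Qed.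

Lemma Cmod_circle (r t : R) : 0 <= r -> Cmod (r * expi t) = r.
Proof. intros H; rewrite Cmod_mult, Cmod_expi, Cmod_R, Rabs_right; lra. Qed.

Lemma Cmod_triangle_inv (x y : C) : Cmod x - Cmod y <= Cmod (x - y).
Proof.
assert (H := Cmod_triangle (x - y) y).
replace (x - y + y)%C with x in H by ring. lra.
Qed.

Lemma exp_nonpos_bounds (x : R) : x <= 0 -> 0 <= exp x <= 1.
Proof.
intros H; split; [left; apply exp_pos|]. rewrite <- exp_0.
destruct H as [H| ->]; [left; now apply exp_increasing|lra].
Qed.

Definition holomorphic_on_disc (f : C -> C) : Prop :=
  forall z, in_disc z -> exists l, complex_derivative f z l.

(** The density in [t] of [dw / (2 pi i (w - z))] along [w = r * expi t]. *)
Definition cauchy_kernel (r : R) (z : C) (t : R) : C :=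
  (r * expi t / (r * expi t - z))%C.

Section Cauchy.

Variables (r : R) (z : C).
Hypothesis Hz : Cmod z < r.
Hypothesis Hr : r < 1.

Lemma circle_minus_bound (t : R) : r - Cmod z <= Cmod (r * expi t - z).
Proof.
pose proof (Cmod_ge_0 z).
eapply Rle_trans; [|apply Cmod_triangle_inv]. rewrite Cmod_circle; lra.
Qed.

Lemma circle_minus_neq_0 (t : R) : (r * expi t - z)%C <> 0%C.
Proof. apply Cmod_gt_0. pose proof (circle_minus_bound t); lra. Qed.

Lemma cauchy_kernel_bound (t : R) : Cmod (cauchy_kernel r z t) <= r / (r - Cmod z).
Proof.
pose proof (Cmod_ge_0 z).
unfold cauchy_kernel. rewrite Cmod_div by apply circle_minus_neq_0.
rewrite Cmod_circle by lra.
apply Rmult_le_compat_l; [lra|].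
apply Rinv_le_contravar; [lra|apply circle_minus_bound].
Qed.

Lemma path_derivable_cauchy_kernel (t : R) : path_derivable (cauchy_kernel r z) t.
Proof.
apply path_derivable_mult; [apply path_derivable_circle|].
apply path_derivable_inv; [|apply circle_minus_neq_0].
apply path_derivable_minus; [apply path_derivable_circle|apply path_derivable_const].
Qed.

Lemma contracted_circle_in_disc (lam t : R) :
  0 <= lam <= 1 -> in_disc (z + lam * (r * expi t - z))%C.
Proof.
intros Hl; unfold in_disc.
replace (z + lam * (r * expi t - z))%C with (RtoC (1 - lam) * z + lam * (r * expi t))%C
  by (rewrite RtoC_minus; ring).
eapply Rle_lt_trans; [apply Cmod_triangle|].
pose proof (Cmod_ge_0 z).
rewrite (Cmod_mult lam), Cmod_circle, Cmod_mult, !Cmod_R, !Rabs_right by lra.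
nra.
Qed.

(** The integral over the contracted loop does not depend on the contraction factor
    [lam = exp (- L)], and [f w - f z] tends to 0 uniformly as [L] grows. Subtracting [f z] avoids
    computing a winding number. The factor [2 pi i] turns the kernel into the logarithmic derivative
    of [r * expi t - z]. *)
Lemma cauchy_formula_re (f : C -> C) : holomorphic_on_disc f ->
  RInt (fun t => Re ((f (r * expi t) - f z) * (2 * PI * Ci * cauchy_kernel r z t))%C) 0 1 = 0.
Proof.
intros Hf.
assert (z0 := Cmod_ge_0 z).
set (k := fun t => (2 * PI * Ci * cauchy_kernel r z t)%C).
assert (Hk : path_derivable01 k).
{ intros t Ht; apply path_derivable_mult; [apply path_derivable_const|].
  apply path_derivable_cauchy_kernel. }
set (u := fun t => (r * expi t - z)%C).
assert (Hu : forall t, path_derivable u t).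
{ intros t; apply path_derivable_minus; [apply path_derivable_circle|apply path_derivable_const]. }
set (K := 2 * PI * (r / (r - Cmod z))).
assert (HK : forall t, Cmod (k t) <= K).
{ intros t; unfold k, K. rewrite !Cmod_mult, Cmod_Ci, !Cmod_R.
  assert (P := PI_RGT_0). rewrite !Rabs_right by lra.
  rewrite Rmult_1_r. apply Rmult_le_compat_l; [lra|apply cauchy_kernel_bound]. }
assert (HK0 : 0 <= K) by (eapply Rle_trans; [apply Cmod_ge_0|apply (HK 0)]).
assert (comp : forall lam, 0 <= lam <= 1 ->
   path_derivable01 (fun t => (f (z + lam * u t) - f z) * k t)%C).
{ intros lam Hl t Ht. apply path_derivable_mult; [|now apply Hk].
  apply path_derivable_minus; [|apply path_derivable_const].
  destruct (Hf _ (contracted_circle_in_disc lam t Hl)) as [l Hfl].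
  apply (path_derivable_comp f (fun t => z + lam * u t)%C t l Hfl).
  apply path_derivable_plus; [apply path_derivable_const|].
  apply path_derivable_mult; [apply path_derivable_const|apply Hu]. }
set (I := fun lam : R => RInt (fun t => Re ((f (z + lam * u t) - f z) * k t)%C) 0 1).
assert (E : forall L, 0 <= L -> I 1 = I (exp (- L))).
{ intros L HL.
  assert (eL : 0 <= exp (- L) <= 1).
  { apply exp_nonpos_bounds; lra. }
  apply Rminus_diag_uniq.
  assert (G := contracted_loop_integral f z u k L).
  unfold I.
  assert (S := RInt_minus (V := R_CompleteNormedModule)
    (fun t => Re ((f (z + 1 * u t) - f z) * k t)%C)
    (fun t => Re ((f (z + exp (- L) * u t) - f z) * k t)%C) 0 1
    (proj1 (path_derivable01_ex_RInt _ (comp 1 ltac:(lra))))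
    (proj1 (path_derivable01_ex_RInt _ (comp _ eL)))).
  etransitivity; [symmetry; exact S|].
  etransitivity; [|apply G].
  - apply RInt_ext_R; intros t. rewrite Cmult_1_l.
    unfold minus, plus, opp; simpl; unfold Re, Im; ring.
  - intros s t Hs Ht. apply Hf, contracted_circle_in_disc.
    apply exp_nonpos_bounds; nra.
  - intros t Ht. destruct (is_derive_expi t) as [D1 D2].
    assert (ku : (k t * u t = 2 * PI * Ci * (r * expi t))%C).
    { unfold k, u, cauchy_kernel. field. apply circle_minus_neq_0. }
    rewrite ku.
    split.
    + apply (is_derive_ext (fun t => r * Re (expi t) - Re z)).
      { intros x; unfold u, Re; simpl; ring. }
      replace (Re (2 * PI * Ci * (r * expi t))%C) with (r * Re (2 * PI * Ci * expi t)%C - 0)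
        by (unfold Re; simpl; ring).
      apply (is_derive_minus (V := R_NormedModule)); [now apply is_derive_scal|].
      apply (is_derive_const (V := R_NormedModule)).
    + apply (is_derive_ext (fun t => r * Im (expi t) - Im z)).
      { intros x; unfold u, Im; simpl; ring. }
      replace (Im (2 * PI * Ci * (r * expi t))%C) with (r * Im (2 * PI * Ci * expi t)%C - 0)
        by (unfold Im; simpl; ring).
      apply (is_derive_minus (V := R_NormedModule)); [now apply is_derive_scal|].
      apply (is_derive_const (V := R_NormedModule)).
  - exact Hk.
  - unfold u; now rewrite expi_0, expi_1. }
assert (B : forall eps, 0 < eps -> Rabs (I 1) <= eps * K).
{ intros eps He.
  destruct (Hf z) as [l Hl]; [unfold in_disc; lra|].
  destruct (complex_derivative_continuous f z l Hl eps He) as [d [dp Hd]].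
  (* This gives [exp (- L) <= d / 4]; as [|u t| < 2], the contracted loop lies within [d] of [z]. *)
  set (L := Rmax 0 (- ln (d / 4))).
  rewrite (E L) by apply Rmax_l.
  assert (eL : exp (- L) <= d / 4).
  { rewrite <- (exp_ln (d / 4)) by lra.
    assert (- ln (d / 4) <= L) by apply Rmax_r.
    destruct (Req_dec (- L) (ln (d / 4))) as [->|N]; [lra|].
    left; apply exp_increasing; lra. }
  assert (eL1 : 0 <= exp (- L) <= 1).
  { apply exp_nonpos_bounds. assert (0 <= L) by apply Rmax_l. lra. }
  unfold I.
  replace (eps * K) with ((1 - 0) * (eps * K)) by ring.
  apply abs_RInt_le_const; [lra|apply (path_derivable01_ex_RInt _ (comp _ eL1))|].
  intros t Ht. eapply Rle_trans; [apply re_le_Cmod|]. rewrite Cmod_mult.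
  apply Rmult_le_compat; try apply Cmod_ge_0; [|apply HK].
  apply Hd. replace (z + exp (- L) * u t - z)%C with (exp (- L) * u t)%C by ring.
  rewrite Cmod_mult, Cmod_R, Rabs_right by lra.
  assert (Cmod (u t) < 2).
  { unfold u, Cminus. eapply Rle_lt_trans; [apply Cmod_triangle|].
    rewrite Cmod_circle, Cmod_opp; lra. }
  pose proof (Cmod_ge_0 (u t)). nra. }
assert (I1 : I 1 = 0).
{ destruct (Req_dec (I 1) 0) as [|N]; [easy|].
  apply Rabs_pos_lt in N.
  specialize (B (Rabs (I 1) / (2 * (K + 1)))).
  assert (0 < Rabs (I 1) / (2 * (K + 1))) as P by (apply Rdiv_lt_0_compat; lra).
  specialize (B P).
  assert (Rabs (I 1) = Rabs (I 1) / (2 * (K + 1)) * (2 * (K + 1))) by (field; lra).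
  nra. }
etransitivity; [|exact I1]. unfold I; apply RInt_ext_R; intros t.
unfold k, u. now replace (z + 1 * (r * expi t - z))%C with (r * expi t)%C by ring.
Qed.

(** Both parts follow from the real formula applied to constant multiples of [f]. The multiple
    [1 / (2 pi i)] restores the integrand itself; the multiple [- 1 / (2 pi)] leaves [- i] times it,
    whose real part is the imaginary part of the integrand. *)
Lemma cauchy_formula (f : C -> C) : holomorphic_on_disc f ->
  CInt (fun t => (f (r * expi t) - f z) * cauchy_kernel r z t)%C = 0%C.
Proof.
intros Hf.
assert (P := PI_RGT_0).
assert (Hc : forall c, holomorphic_on_disc (fun w => c * f w)%C).
{ intros c w Hw; destruct (Hf w Hw) as [l Hl]; exists (c * l)%C.
  now apply complex_derivative_scal. }
change (RtoC 0) with (0, 0); unfold CInt; apply (f_equal2 (@pair R R)).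
- etransitivity; [|exact (cauchy_formula_re _ (Hc (/ (2 * PI * Ci))%C))].
  apply RInt_ext_R; intros t. f_equal.
  field. split; [intros H; apply (f_equal Im) in H; simpl in H; lra|].
  intros H; apply RtoC_inj in H; lra.
- etransitivity; [|exact (cauchy_formula_re _ (Hc (- / (2 * PI))%C))].
  apply RInt_ext_R; intros t.
  set (w := ((f (r * expi t) - f z) * cauchy_kernel r z t)%C).
  replace (_ * _)%C with (- Ci * w)%C at 1.
  + unfold Re, Im; simpl; ring.
  + unfold w; field. intros H; apply RtoC_inj in H; lra.
Qed.

End Cauchy.

(** * Taylor expansion *)

(** The upper bound is exclusive, so that lengths add and multiply when sums are cut into blocks. *)
Fixpoint Csum (f : nat -> C) (n : nat) : C :=
  match n with O => 0%C | S n => (Csum f n + f n)%C end.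

Fixpoint Rsum (f : nat -> R) (n : nat) : R :=
  match n with O => 0 | S n => Rsum f n + f n end.

Lemma Csum_ext (f g : nat -> C) (n : nat) :
  (forall k, (k < n)%nat -> f k = g k) -> Csum f n = Csum g n.
Proof.
induction n as [|n IH]; intros H; simpl; [easy|].
rewrite IH, H; auto with arith.
Qed.

Lemma Csum_plus (f g : nat -> C) (n : nat) :
  Csum (fun k => f k + g k)%C n = (Csum f n + Csum g n)%C.
Proof. induction n as [|n IH]; simpl; [|rewrite IH]; ring. Qed.

Lemma Csum_minus (f g : nat -> C) (n : nat) :
  Csum (fun k => f k - g k)%C n = (Csum f n - Csum g n)%C.
Proof. induction n as [|n IH]; simpl; [|rewrite IH]; ring. Qed.

Lemma Csum_scal_l (c : C) (f : nat -> C) (n : nat) :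
  Csum (fun k => c * f k)%C n = (c * Csum f n)%C.
Proof. induction n as [|n IH]; simpl; [|rewrite IH]; ring. Qed.

Lemma Csum_scal_r (c : C) (f : nat -> C) (n : nat) :
  Csum (fun k => f k * c)%C n = (Csum f n * c)%C.
Proof. induction n as [|n IH]; simpl; [|rewrite IH]; ring. Qed.

Lemma Csum_const (c : C) (n : nat) : Csum (fun _ => c) n = (INR n * c)%C.
Proof.
induction n as [|n IH]; [simpl; ring|].
change (Csum (fun _ => c) (S n)) with (Csum (fun _ => c) n + c)%C.
rewrite IH, S_INR, RtoC_plus; ring.
Qed.

Lemma Csum_conj (f : nat -> C) (n : nat) :
  Cconj (Csum f n) = Csum (fun k => Cconj (f k)) n.
Proof.
induction n as [|n IH]; simpl.
- unfold Cconj, RtoC; simpl; now rewrite Ropp_0.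
- now rewrite Cplus_conj, IH.
Qed.

Lemma Csum_swap (f : nat -> nat -> C) (n m : nat) :
  Csum (fun i => Csum (f i) m) n = Csum (fun j => Csum (fun i => f i j) n) m.
Proof.
induction n as [|n IH]; simpl.
- induction m as [|m IHm]; simpl; [easy|]. rewrite <- IHm; ring.
- now rewrite IH, <- Csum_plus.
Qed.

Lemma Csum_single (f : nat -> C) (n m : nat) : (m < n)%nat ->
  (forall k, (k < n)%nat -> k <> m -> f k = 0%C) -> Csum f n = f m.
Proof.
induction n as [|n IH]; intros Hm H; [lia|]; simpl.
destruct (Nat.eq_dec n m) as [->|N].
- replace (Csum f m) with (RtoC 0); [ring|].
  rewrite (Csum_ext f (fun _ => 0%C)).
  + rewrite Csum_const; ring.
  + intros k Hk; apply H; lia.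
- rewrite IH by (try lia; intros; apply H; lia).
  rewrite (H n) by lia; ring.
Qed.

Lemma Csum_blocks (f : nat -> C) (L N : nat) :
  Csum f (L * N) = Csum (fun l => Csum (fun i => f (l * N + i)%nat) N) L.
Proof.
assert (A : forall n m, Csum f (n + m) = (Csum f n + Csum (fun i => f (n + i)%nat) m)%C).
{ intros n m; induction m as [|m IH]; [rewrite Nat.add_0_r; simpl; ring|].
  rewrite Nat.add_succ_r; simpl; rewrite IH; ring. }
induction L as [|L IH]; [easy|].
replace (S L * N)%nat with (L * N + N)%nat by (simpl; lia).
rewrite A, IH; easy.
Qed.

Lemma RtoC_Rsum (f : nat -> R) (n : nat) : RtoC (Rsum f n) = Csum (fun k => RtoC (f k)) n.
Proof. induction n as [|n IH]; simpl; [easy|]. now rewrite RtoC_plus, IH. Qed.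

Lemma Cmod_Csum_le (f : nat -> C) (n : nat) :
  Cmod (Csum f n) <= Rsum (fun k => Cmod (f k)) n.
Proof.
induction n as [|n IH]; simpl; [rewrite Cmod_0; lra|].
eapply Rle_trans; [apply Cmod_triangle|lra].
Qed.

Lemma Rsum_le (f g : nat -> R) (n : nat) :
  (forall k, (k < n)%nat -> f k <= g k) -> Rsum f n <= Rsum g n.
Proof.
induction n as [|n IH]; intros H; simpl; [lra|].
apply Rplus_le_compat; auto with arith.
Qed.

Lemma Rsum_ext (f g : nat -> R) (n : nat) :
  (forall k, (k < n)%nat -> f k = g k) -> Rsum f n = Rsum g n.
Proof.
intros H; apply Rle_antisym; apply Rsum_le; intros k Hk; rewrite H; trivial; lra.
Qed.

Lemma Rsum_plus (f g : nat -> R) (n : nat) :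
  Rsum (fun k => f k + g k) n = Rsum f n + Rsum g n.
Proof. induction n as [|n IH]; simpl; [|rewrite IH]; ring. Qed.

Lemma Rsum_scal_l (c : R) (f : nat -> R) (n : nat) :
  Rsum (fun k => c * f k) n = c * Rsum f n.
Proof. induction n as [|n IH]; simpl; [|rewrite IH]; ring. Qed.

Lemma Rsum_const (c : R) (n : nat) : Rsum (fun _ => c) n = INR n * c.
Proof.
induction n as [|n IH]; [simpl; ring|].
change (Rsum (fun _ => c) (S n)) with (Rsum (fun _ => c) n + c).
rewrite IH, S_INR; ring.
Qed.

Lemma Rsum_add (f : nat -> R) (n m : nat) :
  Rsum f (n + m) = Rsum f n + Rsum (fun i => f (n + i)%nat) m.
Proof.
induction m as [|m IH]; [rewrite Nat.add_0_r; simpl; ring|].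
rewrite Nat.add_succ_r; simpl; rewrite IH; ring.
Qed.

Lemma Rsum_nonneg (f : nat -> R) (n : nat) :
  (forall k, 0 <= f k) -> 0 <= Rsum f n.
Proof. intros H; induction n as [|n IH]; simpl; [lra|specialize (H n); lra]. Qed.

Lemma Rsum_incr (f : nat -> R) (n m : nat) :
  (forall k, 0 <= f k) -> (n <= m)%nat -> Rsum f n <= Rsum f m.
Proof.
intros H Hnm; replace m with (n + (m - n))%nat by lia.
rewrite Rsum_add. assert (0 <= Rsum (fun i => f (n + i)%nat) (m - n)) by (apply Rsum_nonneg; auto).
lra.
Qed.

(** * Power series from the Cauchy formula *)

Lemma path_derivable_Csum (g : nat -> R -> C) (n : nat) (t : R) :
  (forall k, path_derivable (g k) t) -> path_derivable (fun t => Csum (fun k => g k t) n) t.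
Proof.
intros H; induction n as [|n IH]; simpl; [apply path_derivable_const|].
now apply path_derivable_plus.
Qed.

Lemma CInt_Csum (c : nat -> C) (g : nat -> R -> C) (n : nat) :
  (forall k, path_derivable01 (g k)) ->
  CInt (fun t => Csum (fun k => c k * g k t)%C n) = Csum (fun k => c k * CInt (g k))%C n.
Proof.
intros H.
assert (D : forall k t, 0 <= t <= 1 -> path_derivable (fun t => c k * g k t)%C t).
{ intros k t Ht; apply path_derivable_mult; [apply path_derivable_const|now apply H]. }
induction n as [|n IH]; simpl.
- unfold CInt; simpl. rewrite (RInt_const (V := R_CompleteNormedModule)).
  unfold scal; simpl; unfold mult; simpl; now rewrite Rmult_0_r.
- rewrite CInt_plus.
  + now rewrite IH, CInt_scal.
  + intros t Ht; apply path_derivable_Csum; auto.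
  + intros t Ht; auto.
Qed.

Lemma CInt_expi (k : nat) : CInt (fun t => expi t ^ k)%C = if Nat.eqb k 0 then 1%C else 0%C.
Proof.
destruct k as [|k]; simpl (Nat.eqb _ _); cbv iota.
- unfold CInt; simpl. rewrite !(RInt_const (V := R_CompleteNormedModule)).
  unfold scal; simpl; unfold mult, RtoC; simpl; f_equal; ring.
- assert (P := PI_RGT_0).
  assert (K : 0 < INR (S k)) by (apply lt_0_INR; lia).
  assert (E := expi_INR (S k)).
  set (n := INR (S k)) in *.
  assert (N : 2 * PI * n <> 0) by nra.
  rewrite (CInt_ext _ (fun t => expi (n * t)))
    by (intros t _; unfold n; now rewrite expi_pow).
  injection E; intros E2 E1.
  unfold CInt, RtoC, expi; simpl. apply (f_equal2 (@pair R R)); apply is_RInt_unique.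
  + replace 0 with (minus (sin (2 * PI * (n * 1)) / (2 * PI * n)) (sin (2 * PI * (n * 0)) / (2 * PI * n))) at 2.
    * apply (is_RInt_derive (V := R_CompleteNormedModule) (fun t => sin (2 * PI * (n * t)) / (2 * PI * n))).
      -- intros t _; auto_derive; [easy|field; split; lra].
      -- intros t _; apply (ex_derive_continuous (K := R_AbsRing) (V := R_NormedModule)); auto_derive; easy.
    * rewrite Rmult_1_r, E2, Rmult_0_r, Rmult_0_r, sin_0.
      unfold minus, plus, opp; simpl; field; split; lra.
  + replace 0 with (minus (- cos (2 * PI * (n * 1)) / (2 * PI * n)) (- cos (2 * PI * (n * 0)) / (2 * PI * n))) at 2.
    * apply (is_RInt_derive (V := R_CompleteNormedModule) (fun t => - cos (2 * PI * (n * t)) / (2 * PI * n))).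
      -- intros t _; auto_derive; [easy|field; split; lra].
      -- intros t _; apply (ex_derive_continuous (K := R_AbsRing) (V := R_NormedModule)); auto_derive; easy.
    * rewrite Rmult_1_r, E1, Rmult_0_r, Rmult_0_r, cos_0.
      unfold minus, plus, opp; simpl; field; split; lra.
Qed.

Lemma CInt_conj (g : R -> C) : path_derivable01 g ->
  CInt (fun t => Cconj (g t)) = Cconj (CInt g).
Proof.
intros Hg. unfold CInt, Cconj; simpl. apply (f_equal2 (@pair R R)); [easy|].
apply (RInt_opp (V := R_CompleteNormedModule) (fun t => Im (g t))).
now apply path_derivable01_ex_RInt.
Qed.

(** On the unit circle inversion is conjugation, which reduces negative powers to [CInt_expi]. *)
Lemma CInt_inv_circle_pow (r : R) (k : nat) : 0 < r ->
  CInt (fun t => (/ (r * expi t)) ^ k)%C = if Nat.eqb k 0 then 1%C else 0%C.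
Proof.
intros Hr.
rewrite (CInt_ext _ (fun t => RtoC (/ r ^ k) * Cconj (expi t ^ k))%C).
- assert (D : path_derivable01 (fun t => expi t ^ k)%C).
  { intros t _; apply path_derivable_pow, path_derivable_expi. }
  rewrite CInt_scal, CInt_conj, CInt_expi by
    first [exact D|intros t Ht; destruct (D t Ht) as [D1 D2]; split;
     [exact D1|apply (ex_derive_opp (V := R_NormedModule)); exact D2]].
  destruct k as [|k]; simpl (Nat.eqb _ _); cbv iota.
  + simpl. unfold Cconj, Cmult, RtoC; simpl; f_equal; field.
  + unfold Cconj, Cmult, RtoC; simpl; f_equal; ring.
- intros t _.
  rewrite Cpow_conj, <- expi_opp, expi_inv, RtoC_inv, RtoC_pow, <- Cpow_inv, <- Cpow_mult_l.
  + f_equal. field. split; [apply expi_neq_0|intros H; apply RtoC_inj in H; lra].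
  + intros H; apply RtoC_inj in H; lra.
  + apply pow_nonzero; lra.
Qed.

Lemma geometric_expansion (q : C) (n : nat) : (1 - q)%C <> 0%C ->
  (/ (1 - q))%C = (Csum (fun k => q ^ k) n + q ^ n * / (1 - q))%C.
Proof.
intros H; induction n as [|n IH]; simpl; [ring|].
rewrite IH at 1. field. exact H.
Qed.

(** The kernel is [1 / (1 - z / w)], expanded geometrically in the Cauchy formula. The subtracted
    constant [f z] survives only in the term [k = 0], where it becomes the value being expanded. In
    [4 * M], one factor 2 is that of [CInt_bound], the other comes from [|f w - f z| <= 2 * M]. *)
Lemma taylor_on_circle (f : C -> C) (M r : R) :
  holomorphic_on_disc f -> (forall z, in_disc z -> Cmod (f z) <= M) -> 0 < r < 1 ->
  exists a : nat -> C, forall z n, Cmod z < r ->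
    Cmod (f z - Csum (fun k => a k * z ^ k) (S n))%C
      <= 4 * M * (r / (r - Cmod z)) * (Cmod z / r) ^ (S n).
Proof.
intros Hf HM Hr.
assert (disc : forall t, in_disc (r * expi t)).
{ intros t; unfold in_disc; rewrite Cmod_circle; lra. }
assert (w0 : forall t, (r * expi t)%C <> 0%C).
{ intros t; apply Cmod_gt_0; rewrite Cmod_circle; lra. }
assert (dinv : forall k t, path_derivable (fun t => (/ (r * expi t)) ^ k)%C t).
{ intros k t; apply (path_derivable_pow (fun t => / (r * expi t))%C).
  apply path_derivable_inv; [apply path_derivable_circle|apply w0]. }
assert (df : forall t, path_derivable (fun t => f (r * expi t)%C) t).
{ intros t; destruct (Hf _ (disc t)) as [l Hl].
  apply (path_derivable_comp f (fun t => r * expi t)%C t l Hl). apply path_derivable_circle. }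
exists (fun k => CInt (fun t => f (r * expi t) * (/ (r * expi t)) ^ k)%C).
intros z n Hz.
pose proof (Cmod_ge_0 z).
assert (Hzd : in_disc z) by (unfold in_disc; lra).
(* At least one term must be kept, because index 0 carries [f z]. *)
set (K := S n).
set (G := fun k t => ((f (r * expi t) - f z) * (/ (r * expi t)) ^ k)%C).
set (T := fun t => ((f (r * expi t) - f z) * (z * / (r * expi t)) ^ K * cauchy_kernel r z t)%C).
assert (dG : forall k, path_derivable01 (G k)).
{ intros k t Ht; apply path_derivable_mult; [|apply dinv].
  apply path_derivable_minus; [apply df|apply path_derivable_const]. }
assert (dT : path_derivable01 T).
{ intros t Ht; apply path_derivable_mult; [apply path_derivable_mult|].
  - apply path_derivable_minus; [apply df|apply path_derivable_const].
  - apply (path_derivable_pow (fun t => z * / (r * expi t))%C).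
    apply path_derivable_mult; [apply path_derivable_const|].
    apply path_derivable_inv; [apply path_derivable_circle|apply w0].
  - now apply path_derivable_cauchy_kernel. }
assert (E : (Csum (fun k => z ^ k * CInt (G k)) K + CInt T = 0)%C).
{ rewrite <- (cauchy_formula r z Hz (proj2 Hr) f Hf).
  rewrite <- CInt_Csum by exact dG.
  rewrite <- CInt_plus.
  - apply CInt_ext; intros t Ht.
    unfold T, G.
    rewrite (Csum_ext _ (fun k => (f (r * expi t) - f z) * (z * / (r * expi t)) ^ k)%C)
      by (intros k _; rewrite Cpow_mult_l; ring).
    rewrite Csum_scal_l.
    assert (Hq : cauchy_kernel r z t = (/ (1 - z * / (r * expi t)))%C).
    { unfold cauchy_kernel. field.
      repeat split; first [apply expi_neq_0|now apply circle_minus_neq_0|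
        intros Hc; apply RtoC_inj in Hc; lra]. }
    rewrite Hq.
    assert (Hg := geometric_expansion (z * / (r * expi t)) K).
    set (q := (z * / (r * expi t))%C) in *.
    change (Csum (Cpow q) K) with (Csum (fun k => (q ^ k)%C) K). rewrite Hg at 2; [ring|].
    unfold q; intros Hc. apply (circle_minus_neq_0 r z Hz t).
    replace (r * expi t - z)%C with (r * expi t * (1 - z * / (r * expi t)))%C.
    + rewrite Hc; ring.
    + field. split; [apply expi_neq_0|]. intros Hc'; apply RtoC_inj in Hc'; lra.
  - intros t Ht; apply path_derivable_Csum; intros k.
    apply path_derivable_mult; [apply path_derivable_const|now apply dG].
  - exact dT. }
assert (EG : forall k, CInt (G k) =
   (CInt (fun t => f (r * expi t) * (/ (r * expi t)) ^ k) - if Nat.eqb k 0 then f z else 0)%C).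
{ intros k. unfold G.
  rewrite (CInt_ext _ (fun t => f (r * expi t) * (/ (r * expi t)) ^ k + (- f z) * (/ (r * expi t)) ^ k)%C)
    by (intros; ring).
  rewrite CInt_plus, CInt_scal, CInt_inv_circle_pow; try lra.
  - destruct (Nat.eqb k 0); ring.
  - intros t _; apply dinv.
  - intros t _; apply path_derivable_mult; [apply df|apply dinv].
  - intros t _; apply path_derivable_mult; [apply path_derivable_const|apply dinv]. }
rewrite (Csum_ext _ (fun k => CInt (fun t => f (r * expi t) * (/ (r * expi t)) ^ k) * z ^ k
   - (if Nat.eqb k 0 then f z else 0) * z ^ k)%C) in E
  by (intros k _; rewrite EG; ring).
rewrite Csum_minus in E.
rewrite (Csum_single (fun k => (if Nat.eqb k 0 then f z else 0) * z ^ k)%C K 0) in E;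
  [|unfold K; lia|intros [|k] _ Hk; [easy|simpl; ring]].
simpl (Nat.eqb 0 0) in E; cbv iota in E; simpl (z ^ 0)%C in E.
replace (f z - _)%C with (CInt T).
2:{ transitivity (CInt T - 0)%C; [ring|]. rewrite <- E at 1. ring. }
eapply Rle_trans; [apply (CInt_bound T (2 * M * (Cmod z / r) ^ K * (r / (r - Cmod z))) dT)|].
- intros t Ht; unfold T. rewrite !Cmod_mult, Cmod_pow, Cmod_mult, Cmod_inv, Cmod_circle by (try apply w0; lra).
  assert (0 <= Cmod z * / r) by (apply Rmult_le_pos; [easy|left; apply Rinv_0_lt_compat; lra]).
  apply Rmult_le_compat; [|apply Cmod_ge_0| |now apply cauchy_kernel_bound].
  + apply Rmult_le_pos; [apply Cmod_ge_0|now apply pow_le].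
  + apply Rmult_le_compat_r; [now apply pow_le|].
    unfold Cminus. eapply Rle_trans; [apply Cmod_triangle|]. rewrite Cmod_opp.
    assert (A := HM _ (disc t)). assert (B := HM _ Hzd). lra.
- apply Req_le; ring.
Qed.

(** Once the lower coefficients agree, taking real [z = x], stopping after index [m] and dividing by
    [x ^ m] bounds the difference at [m] by a multiple of [x]. *)
Lemma taylor_coefficients_unique (a b : nat -> C) (d B q : R) : 0 < d ->
  (forall z n, Cmod z < d ->
     Cmod (Csum (fun k => a k * z ^ k) (S n) - Csum (fun k => b k * z ^ k) (S n))%C
       <= B * (Cmod z * q) ^ (S n)) ->
  forall m, a m = b m.
Proof.
intros Hd H m; induction m as [m IH] using (well_founded_induction Nat.lt_wf_0).
set (E := Cmod (a m - b m)).
assert (K : forall x, 0 < x < d -> E <= B * q ^ S m * x).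
{ intros x Hx.
  assert (Cx : Cmod x = x) by (rewrite Cmod_R, Rabs_right; lra).
  specialize (H (RtoC x) m). rewrite Cx in H. specialize (H (proj2 Hx)).
  rewrite <- Csum_minus in H.
  rewrite (Csum_single _ (S m) m) in H; [|lia|].
  2:{ intros k Hk Hkm; rewrite IH by lia; ring. }
  replace (a m * x ^ m - b m * x ^ m)%C with ((a m - b m) * x ^ m)%C in H by ring.
  rewrite Cmod_mult, Cmod_pow, Cx in H. fold E in H.
  assert (xm : 0 < x ^ m) by (apply pow_lt; lra).
  apply Rmult_le_reg_r with (x ^ m); [easy|].
  replace (B * q ^ S m * x * x ^ m) with (B * (x * q) ^ S m); [easy|].
  rewrite Rpow_mult_distr; simpl; ring. }
assert (E0 : E = 0).
{ destruct (Req_dec E 0) as [|N]; [easy|exfalso].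
  assert (EP : 0 < E) by (pose proof (Cmod_ge_0 (a m - b m)); unfold E in *; lra).
  set (A := Rabs (B * q ^ S m)).
  assert (HA : B * q ^ S m <= A) by apply Rle_abs.
  assert (A0 : 0 <= A) by apply Rabs_pos.
  (* Then [A * x] is below [E], against [E <= A * x]. *)
  set (x := Rmin (d / 2) (E / (2 * (A + 1)))).
  assert (x1 : x <= d / 2) by apply Rmin_l.
  assert (x2 : x <= E / (2 * (A + 1))) by apply Rmin_r.
  assert (x0 : 0 < x) by (apply Rmin_pos; [lra|apply Rdiv_lt_0_compat; lra]).
  specialize (K x ltac:(lra)).
  assert (E = E / (2 * (A + 1)) * (2 * (A + 1))) by (field; lra).
  nra. }
apply Cmod_eq_0 in E0. rewrite <- (Cplus_0_l (b m)), <- E0. ring.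
Qed.

(** The coefficients of [taylor_on_circle] depend on the radius. Those of radius 1/2 are fixed and
    identified with those of a radius between [s] and 1. Uniformity on [|z| = s] is what sampling
    needs. *)
Lemma taylor_expansion (f : C -> C) (M : R) :
  holomorphic_on_disc f -> (forall z, in_disc z -> Cmod (f z) <= M) ->
  exists a : nat -> C, forall s, 0 <= s < 1 -> forall eps, 0 < eps ->
    exists n0, forall n z, (n0 <= n)%nat -> Cmod z = s ->
      Cmod (f z - Csum (fun k => a k * z ^ k) n)%C <= eps.
Proof.
intros Hf HM.
assert (M0 : 0 <= M).
{ eapply Rle_trans; [apply Cmod_ge_0|apply (HM 0%C)]. unfold in_disc; rewrite Cmod_0; lra. }
destruct (taylor_on_circle f M (1 / 2) Hf HM ltac:(lra)) as [a Ha].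
exists a; intros s Hs eps He.
set (r := (1 + s) / 2).
destruct (taylor_on_circle f M r Hf HM ltac:(unfold r; lra)) as [b Hb].
assert (ab : forall k, a k = b k).
{ apply (taylor_coefficients_unique a b (1 / 4) (16 * M) 2); [lra|].
  intros z n Hz. pose proof (Cmod_ge_0 z).
  assert (Hr : 1 / 2 <= r) by (unfold r; lra).
  specialize (Ha z n ltac:(lra)). specialize (Hb z n ltac:(lra)).
  replace (_ - _)%C with ((f z - Csum (fun k => b k * z ^ k) (S n))
     - (f z - Csum (fun k => a k * z ^ k) (S n)))%C by ring.
  unfold Cminus at 1. eapply Rle_trans; [apply Cmod_triangle|]. rewrite Cmod_opp.
  (* For [|z| < 1 / 4] and [r' >= 1 / 2], [r' / (r' - |z|) <= 2] and [|z| / r' <= 2 * |z|]: hence 8,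
     and 16 for the two expansions. *)
  assert (Q : forall r', 1 / 2 <= r' ->
    4 * M * (r' / (r' - Cmod z)) * (Cmod z / r') ^ S n <= 8 * M * (Cmod z * 2) ^ S n).
  { intros r' Hr'. apply Rmult_le_compat.
    - apply Rmult_le_pos; [lra|]. apply Rmult_le_pos; [lra|]. left; apply Rinv_0_lt_compat; lra.
    - apply pow_le, Rmult_le_pos; [easy|]. left; apply Rinv_0_lt_compat; lra.
    - replace (8 * M) with (4 * M * 2) by ring.
      apply Rmult_le_compat_l; [lra|].
      apply Rmult_le_reg_r with (r' - Cmod z); [lra|].
      unfold Rdiv; rewrite Rmult_assoc, Rinv_l by lra; lra.
    - apply pow_incr; split.
      + apply Rmult_le_pos; [easy|]. left; apply Rinv_0_lt_compat; lra.
      + apply Rmult_le_compat_l; [easy|].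
        replace 2 with (/ (1 / 2)) by field. apply Rinv_le_contravar; lra. }
  assert (Q1 := Q (1 / 2) ltac:(lra)). assert (Q2 := Q r Hr).
  replace (16 * M * (Cmod z * 2) ^ S n)
    with (8 * M * (Cmod z * 2) ^ S n + 8 * M * (Cmod z * 2) ^ S n) by ring.
  lra. }
set (A := 4 * M * (r / (r - s))).
assert (r - s > 0) by (unfold r; lra).
assert (A0 : 0 <= A).
{ apply Rmult_le_pos; [lra|]. apply Rmult_le_pos; [unfold r; lra|].
  left; apply Rinv_0_lt_compat; lra. }
assert (q : 0 <= s / r < 1).
{ split; [apply Rmult_le_pos; [lra|]; left; apply Rinv_0_lt_compat; unfold r; lra|].
  apply Rmult_lt_reg_r with r; [unfold r; lra|].
  unfold Rdiv; rewrite Rmult_assoc, Rinv_l by (unfold r; lra). lra. }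
destruct (pow_lt_1_zero (s / r)) with (y := eps / (A + 1)) as [N HN].
- rewrite Rabs_right; lra.
- apply Rdiv_lt_0_compat; lra.
- exists (S N); intros n z Hn Hz.
  destruct n as [|n]; [lia|].
  specialize (Hb z n ltac:(rewrite Hz; lra)). rewrite Hz in Hb. fold A in Hb.
  rewrite (Csum_ext _ (fun k => b k * z ^ k)%C) by (intros k _; now rewrite ab).
  eapply Rle_trans; [exact Hb|].
  specialize (HN (S n) ltac:(lia)). rewrite Rabs_right in HN by (apply Rle_ge, pow_le; lra).
  assert (eps = eps / (A + 1) * (A + 1)) by (field; lra).
  assert (0 <= (s / r) ^ S n) by (apply pow_le; lra).
  nra.
Qed.

(** * Means over roots of unity *)

Definition primitive_root (N : nat) (w : C) : Prop :=
  (0 < N)%nat /\ Cmod w = 1 /\ (w ^ N)%C = 1%C /\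
  forall d, (0 < d < N)%nat -> (w ^ d)%C <> 1%C.

Lemma primitive_root_expi (N : nat) : (0 < N)%nat -> primitive_root N (expi (/ INR N)).
Proof.
intros HN.
assert (N0 : 0 < INR N) by (now apply lt_0_INR).
split; [easy|split; [apply Cmod_expi|split]].
- rewrite <- expi_pow, Rinv_r by lra. apply expi_1.
- intros d Hd E. rewrite <- expi_pow in E.
  injection E; intros _ E1.
  assert (P := PI_RGT_0).
  assert (d0 : 0 < INR d) by (apply lt_0_INR; lia).
  assert (dN : INR d < INR N) by (apply lt_INR; lia).
  (* With [0 < x < PI], [cos (2 * x) = 1] would force [sin x = 0]. *)
  set (x := PI * (INR d * / INR N)) in *.
  replace (2 * PI * (INR d * / INR N)) with (2 * x) in E1 by (unfold x; ring).
  assert (q : 0 < INR d * / INR N < 1).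
  { split; [apply Rdiv_lt_0_compat; lra|].
    apply Rmult_lt_reg_r with (INR N); [easy|]. rewrite Rmult_assoc, Rinv_l; lra. }
  assert (S : 0 < sin x) by (apply sin_gt_0; unfold x; nra).
  rewrite cos_2a_sin in E1. nra.
Qed.

Lemma Cmod_neq_0 (w : C) : Cmod w = 1 -> w <> 0%C.
Proof. intros H; apply Cmod_gt_0; lra. Qed.

Lemma unit_conj_mult (w : C) : Cmod w = 1 -> (w * Cconj w)%C = 1%C.
Proof. intros H; rewrite <- Cmod2_conj, H. f_equal; ring. Qed.

Lemma geometric_sum (q : C) (n : nat) : ((1 - q) * Csum (fun k => q ^ k) n)%C = (1 - q ^ n)%C.
Proof.
induction n as [|n IH]; simpl; [ring|].
rewrite Cmult_plus_distr_l, IH; ring.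
Qed.

Lemma Csum_root_zero (q : C) (n : nat) : (q ^ n)%C = 1%C -> q <> 1%C ->
  Csum (fun k => q ^ k)%C n = 0%C.
Proof.
intros H1 Hq.
assert (G := geometric_sum q n). rewrite H1 in G.
replace (1 - 1)%C with (RtoC 0) in G by ring.
destruct (Ceq_dec (Csum (fun k => (q ^ k)%C) n) 0) as [|N]; [easy|].
exfalso; apply Hq.
replace q with (1 - (1 - q) * Csum (fun k => q ^ k) n * / Csum (fun k => q ^ k) n)%C.
- rewrite G; ring.
- field; exact N.
Qed.

Section Sampling.

Variables (N : nat) (w : C).
Hypothesis Hw : primitive_root N w.

Lemma root_orthogonality (i m : nat) : (i < N)%nat -> (m < N)%nat ->
  Csum (fun j => (w ^ j) ^ i * Cconj ((w ^ j) ^ m))%C N = if Nat.eqb i m then INR N else 0%C.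
Proof.
intros Hi Hm. destruct Hw as (N0 & w1 & wN & wd).
assert (A : forall n, Cmod (w ^ n) = 1) by (intros n; rewrite Cmod_pow, w1; apply pow1).
rewrite (Csum_ext _ (fun j => (w ^ i * Cconj (w ^ m)) ^ j)%C).
2:{ intros j _. rewrite Cpow_mult_l, <- Cpow_conj, <- !Cpow_mult_r.
    now rewrite (Nat.mul_comm i), (Nat.mul_comm m). }
destruct (Nat.eqb_spec i m) as [->|D].
- rewrite unit_conj_mult by apply A.
  rewrite (Csum_ext _ (fun _ => RtoC 1)) by (intros; apply Cpow_1_l).
  rewrite Csum_const; ring.
- apply Csum_root_zero.
  + rewrite Cpow_mult_l, <- Cpow_conj, <- !Cpow_mult_r.
    rewrite (Nat.mul_comm i), (Nat.mul_comm m), !Cpow_mult_r, wN, !Cpow_1_l.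
    unfold Cconj, Cmult, RtoC; simpl; f_equal; ring.
  + intros E.
    assert (E' : (w ^ i = w ^ m)%C).
    { rewrite <- (Cmult_1_l (w ^ m)), <- E.
      rewrite <- Cmult_assoc, (Cmult_comm (Cconj _)), unit_conj_mult by apply A. ring. }
    assert (C : forall a b, (a < b)%nat -> (b < N)%nat -> (w ^ a)%C = (w ^ b)%C -> False).
    { intros a b ab bN Eab. apply (wd (b - a)%nat); [lia|].
      replace b with (a + (b - a))%nat in Eab by lia. rewrite Cpow_add_r in Eab.
      assert (wa : (w ^ a)%C <> 0%C) by apply Cmod_neq_0, A.
      apply (f_equal (Cmult (/ w ^ a))) in Eab.
      rewrite Cmult_assoc, !Cinv_l, Cmult_1_l in Eab by exact wa. now symmetry. }
    destruct (Nat.lt_total i m) as [L|[L|L]]; [|easy|].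
    * now apply (C i m).
    * now apply (C m i).
Qed.

Lemma discrete_parseval (c : nat -> C) :
  Rsum (fun j => Cmod (Csum (fun k => c k * (w ^ j) ^ k)%C N) ^ 2) N
  = INR N * Rsum (fun k => Cmod (c k) ^ 2) N.
Proof.
apply RtoC_inj. rewrite RtoC_mult, !RtoC_Rsum.
rewrite (Csum_ext _ (fun j => Csum (fun k => Csum (fun l =>
   c k * Cconj (c l) * ((w ^ j) ^ k * Cconj ((w ^ j) ^ l))) N) N)%C).
- rewrite Csum_swap, <- Csum_scal_l. apply Csum_ext; intros k Hk.
  rewrite Csum_swap, (Csum_single _ N k Hk).
  + rewrite Csum_scal_l, root_orthogonality by easy.
    rewrite Nat.eqb_refl, Cmod2_conj; ring.
  + intros l Hl Hlk. rewrite Csum_scal_l, root_orthogonality by easy.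
    destruct (Nat.eqb_spec k l) as [->|_]; [easy|ring].
- intros j _. rewrite Cmod2_conj, Csum_conj, <- Csum_scal_r.
  apply Csum_ext; intros k _. rewrite <- Csum_scal_l.
  apply Csum_ext; intros l _. rewrite Cmult_conj; ring.
Qed.

(** On the sample points exponents congruent modulo [N] give the same power, so orthogonality
    isolates a whole residue class. The degree is a multiple of [N] so that every class is cut at
    the same length. *)
Lemma aliasing (c : nat -> C) (L m : nat) : (m < N)%nat ->
  Csum (fun j => Csum (fun k => c k * (w ^ j) ^ k) (L * N) * Cconj ((w ^ j) ^ m))%C N
  = (INR N * Csum (fun l => c (l * N + m)%nat) L)%C.
Proof.
intros Hm.
assert (wN : forall j l, ((w ^ j) ^ (l * N))%C = 1%C).
{ intros j l. destruct Hw as (_ & _ & E & _).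
  rewrite <- Cpow_mult_r. replace (j * (l * N))%nat with (N * (j * l))%nat by lia.
  rewrite Cpow_mult_r, E. apply Cpow_1_l. }
rewrite (Csum_ext _ (fun j => Csum (fun l => Csum (fun i =>
  c (l * N + i)%nat * ((w ^ j) ^ i * Cconj ((w ^ j) ^ m))) N) L)%C).
- rewrite Csum_swap, <- Csum_scal_l. apply Csum_ext; intros l _.
  rewrite Csum_swap, (Csum_single _ N m Hm).
  + rewrite Csum_scal_l, root_orthogonality, Nat.eqb_refl by easy; ring.
  + intros i Hi Him. rewrite Csum_scal_l, root_orthogonality by easy.
    destruct (Nat.eqb_spec i m) as [->|_]; [easy|ring].
- intros j _. rewrite Csum_blocks, <- Csum_scal_r.
  apply Csum_ext; intros l _. rewrite <- Csum_scal_r.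
  apply Csum_ext; intros i _. rewrite Cpow_add_r, wN; ring.
Qed.

Lemma aliasing_bound (c : nat -> C) (L m : nat) : (m < N)%nat ->
  INR N * Cmod (Csum (fun l => c (l * N + m)%nat) L)
  <= Rsum (fun j => Cmod (Csum (fun k => c k * (w ^ j) ^ k)%C (L * N))) N.
Proof.
intros Hm.
rewrite <- (Rabs_right (INR N)) by (apply Rle_ge, pos_INR).
rewrite <- Cmod_R, <- Cmod_mult, <- aliasing by easy.
eapply Rle_trans; [apply Cmod_Csum_le|].
apply Rsum_le; intros j _. destruct Hw as (_ & w1 & _).
rewrite Cmod_mult, Cmod_conj, !Cmod_pow, w1, !pow1; lra.
Qed.

End Sampling.

(** * Square summability and the lower bound for sample means *)

Lemma Rsum_ge_term (f : nat -> R) (n m : nat) :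
  (forall k, 0 <= f k) -> (m < n)%nat -> f m <= Rsum f n.
Proof.
intros H Hm. eapply Rle_trans; [|apply (Rsum_incr f (S m) n H Hm)]; simpl.
pose proof (Rsum_nonneg f m H); lra.
Qed.

Lemma Rsum_subsample (A : nat -> R) (N m L : nat) :
  (forall k, 0 <= A k) -> (m < N)%nat ->
  Rsum (fun l => A (l * N + m)%nat) L <= Rsum A (L * N).
Proof.
intros HA Hm; induction L as [|L IH]; [simpl; lra|].
replace (S L * N)%nat with (L * N + N)%nat by lia.
rewrite Rsum_add. apply Rplus_le_compat; [easy|].
now apply (Rsum_ge_term (fun i => A (L * N + i)%nat)).
Qed.

Lemma taylor_coefficients_square_summable (f : C -> C) (M : R) (a : nat -> C) :
  (forall z, in_disc z -> Cmod (f z) <= M) ->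
  (forall s, 0 <= s < 1 -> forall eps, 0 < eps ->
     exists n0, forall n z, (n0 <= n)%nat -> Cmod z = s ->
       Cmod (f z - Csum (fun k => a k * z ^ k) n)%C <= eps) ->
  forall n, Rsum (fun k => Cmod (a k) ^ 2) n <= 2 * (M + 1) ^ 2.
Proof.
intros HM Ha n.
assert (K : forall s, 0 <= s < 1 -> Rsum (fun k => Cmod (a k) ^ 2 * s ^ (2 * k)) n <= (M + 1) ^ 2).
{ intros s Hs. destruct (Ha s Hs 1 Rlt_0_1) as [n0 Hn0].
  (* More sample points than the [n] coefficients wanted, and a degree past [n0], where the Taylor
     polynomial is within 1 of [f] and so at most [M + 1] in modulus. *)
  set (N := S (n + n0)).
  assert (Hw := primitive_root_expi N ltac:(unfold N; lia)).
  set (w := expi (/ INR N)) in *.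
  assert (P := discrete_parseval N w Hw (fun k => a k * RtoC s ^ k)%C).
  assert (N0 : 0 < INR N) by (apply lt_0_INR; unfold N; lia).
  eapply Rle_trans; [apply (Rsum_incr _ n N)|].
  - intros k; apply Rmult_le_pos; [apply pow2_ge_0|apply pow_le; lra].
  - unfold N; lia.
  - apply Rmult_le_reg_l with (INR N); [easy|].
    rewrite <- (Rsum_const ((M + 1) ^ 2) N).
    rewrite (Rsum_ext _ (fun k => Cmod (a k * RtoC s ^ k) ^ 2)).
    2:{ intros k _. rewrite Cmod_mult, Cmod_pow, Cmod_R, Rabs_right by lra.
        rewrite Rpow_mult_distr, <- !pow_mult. now rewrite (Nat.mul_comm 2 k). }
    rewrite <- P. apply Rsum_le; intros j _.
    apply pow_incr; split; [apply Cmod_ge_0|].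
    set (z := (s * w ^ j)%C).
    assert (zs : Cmod z = s).
    { unfold z. destruct Hw as (_ & w1 & _).
      rewrite Cmod_mult, Cmod_pow, w1, pow1, Cmod_R, Rabs_right; lra. }
    specialize (Hn0 N z ltac:(unfold N; lia) zs).
    rewrite (Csum_ext _ (fun k => a k * z ^ k)%C)
      by (intros k _; unfold z; rewrite Cpow_mult_l; ring).
    assert (B := HM z ltac:(unfold in_disc; lra)).
    assert (T := Cmod_triangle_inv (Csum (fun k => a k * z ^ k)%C N) (f z)).
    replace (f z - _)%C with (- (Csum (fun k => a k * z ^ k) N - f z))%C in Hn0 by ring.
    rewrite Cmod_opp in Hn0. lra. }
(* An explicit radius [1 - x] replaces the limit at 1: for [k < n] Bernoulli gives [(1 - x) ^ (2 *
   k) >= 1 - 2 * k * x >= 1 / 2], which costs the factor 2. *)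
set (x := / (4 * (INR n + 1))).
assert (n0 := pos_INR n).
assert (x0 : 0 < x <= 1 / 4).
{ split; [apply Rinv_0_lt_compat; lra|].
  replace (1 / 4) with (/ 4) by field. apply Rinv_le_contravar; lra. }
assert (nx : INR n * x <= 1 / 4).
{ apply Rmult_le_reg_r with (4 * (INR n + 1)); [lra|].
  unfold x; rewrite Rmult_assoc, Rinv_l by lra; lra. }
assert (B : forall m, 1 - INR m * x <= (1 - x) ^ m).
{ induction m as [|m IH]; [simpl; lra|].
  rewrite S_INR; simpl. pose proof (pos_INR m). nra. }
specialize (K (1 - x) ltac:(lra)).
assert (H : 1 / 2 * Rsum (fun k => Cmod (a k) ^ 2) n
   <= Rsum (fun k => Cmod (a k) ^ 2 * (1 - x) ^ (2 * k)) n).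
{ rewrite <- Rsum_scal_l. apply Rsum_le; intros k Hk.
  rewrite Rmult_comm. apply Rmult_le_compat_l; [apply pow2_ge_0|].
  eapply Rle_trans; [|apply B]. rewrite mult_INR.
  assert (INR k <= INR n) by (apply le_INR; lia). simpl (INR 2). nra. }
lra.
Qed.

Lemma bounded_increasing_tail (S : nat -> R) (B eta : R) :
  (forall n, S n <= B) -> 0 < eta -> exists n0, forall n, S n <= S n0 + eta.
Proof.
intros HB He.
destruct (completeness (fun x => exists n, x = S n)) as [l [Hu Hl]].
- exists B; intros x [n ->]; apply HB.
- now exists (S O), O.
- destruct (classic (exists n0, l - eta < S n0)) as [[n0 H]|H].
  + exists n0; intros n. assert (S n <= l) by (apply Hu; now exists n). lra.
  + exfalso. assert (l <= l - eta); [|lra].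
    apply Hl; intros x [n ->]. apply Rnot_lt_le; intros Hn; apply H; now exists n.
Qed.

Lemma Rsum_geometric_le (q : R) (n : nat) : 0 <= q <= 1 / 2 -> Rsum (fun l => q ^ S l) n <= 1.
Proof.
intros Hq.
assert (A : Rsum (fun l => q ^ S l) n <= 1 - q ^ n).
{ induction n as [|n IH]; [simpl; lra|].
  change (Rsum (fun l => q ^ S l) (S n)) with (Rsum (fun l => q ^ S l) n + q ^ S n).
  change (q ^ S n) with (q * q ^ n). assert (0 <= q ^ n) by (apply pow_le; lra). nra. }
assert (0 <= q ^ n) by (apply pow_le; lra). lra.
Qed.

Lemma some_taylor_coefficient_neq_0 (f : C -> C) (a : nat -> C) :
  not_identically_zero f ->
  (forall s, 0 <= s < 1 -> forall eps, 0 < eps ->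
     exists n0, forall n z, (n0 <= n)%nat -> Cmod z = s ->
       Cmod (f z - Csum (fun k => a k * z ^ k) n)%C <= eps) ->
  exists m, a m <> 0%C.
Proof.
intros [z [Hz Hfz]] Ha.
apply not_all_not_ex; intros H.
apply Cmod_gt_0 in Hfz.
destruct (Ha (Cmod z) (conj (Cmod_ge_0 z) Hz) (Cmod (f z) / 2) ltac:(lra)) as [n0 Hn].
specialize (Hn n0 z (Nat.le_refl _) eq_refl).
rewrite (Csum_ext _ (fun _ => RtoC 0)) in Hn.
- rewrite Csum_const in Hn. replace (f z - INR n0 * 0)%C with (f z) in Hn by ring. lra.
- intros k _. specialize (H k). apply NNPP in H. rewrite H; ring.
Qed.

(* On the [N]-th roots of unity the discrete Fourier coefficient of [f] differs from
   [a m r ^ m] by the aliased coefficients [a (l N + m)], [l >= 1], which are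
   controlled by the tail of the square-summable sequence [a]. *)
Lemma sample_mean_lower_bound (f : C -> C) (M : R) :
  holomorphic_on_disc f -> (forall z, in_disc z -> Cmod (f z) <= M) ->
  not_identically_zero f ->
  exists c N0, 0 < c /\ forall N w r, (N0 <= N)%nat -> primitive_root N w ->
    1 / 2 <= r < 1 -> r ^ (2 * N) <= 1 / 2 ->
    c * INR N <= Rsum (fun j => Cmod (f (r * w ^ j)%C)) N.
Proof.
intros Hf HM Hnz.
destruct (taylor_expansion f M Hf HM) as [a Ha].
destruct (some_taylor_coefficient_neq_0 f a Hnz Ha) as [m Hm].
apply Cmod_gt_0 in Hm.
(* A lower bound for [|a m| * r ^ m], valid for all [r >= 1 / 2]. *)
set (c := Cmod (a m) * (1 / 2) ^ m).
assert (c0 : 0 < c) by (apply Rmult_lt_0_compat; [easy|apply pow_lt; lra]).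
set (S := Rsum (fun k => Cmod (a k) ^ 2)).
destruct (bounded_increasing_tail S _ (c ^ 2 / 4)
  (taylor_coefficients_square_summable f M a HM Ha)) as [n0 Hn0].
{ assert (0 < c ^ 2) by now apply pow_lt. lra. }
(* Of [c], the aliased terms take at most [c / 2] and Taylor truncation at most [c / 4]. The
   threshold puts [m] below [N] and the aliased indices beyond [n0]. *)
exists (c / 4), (Nat.max n0 (Datatypes.S m)); split; [lra|].
intros N w r HN Hw Hr HrN.
destruct (Ha r ltac:(lra) (c / 4) ltac:(lra)) as [k0 Hk0].
set (L := Datatypes.S k0).
assert (Nm : (m < N)%nat) by lia.
assert (N0 : 0 < INR N) by (apply lt_0_INR; lia).
assert (B := aliasing_bound N w Hw (fun k => a k * RtoC r ^ k)%C L m Nm).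
assert (B2 : Rsum (fun j => Cmod (Csum (fun k => a k * RtoC r ^ k * (w ^ j) ^ k)%C (L * N))) N
  <= Rsum (fun j => Cmod (f (r * w ^ j)%C)) N + INR N * (c / 4)).
{ rewrite <- Rsum_const, <- Rsum_plus. apply Rsum_le; intros j _.
  set (z := (r * w ^ j)%C).
  assert (zr : Cmod z = r).
  { unfold z. destruct Hw as (_ & w1 & _).
    rewrite Cmod_mult, Cmod_pow, w1, pow1, Cmod_R, Rabs_right; lra. }
  specialize (Hk0 (L * N)%nat z ltac:(unfold L; nia) zr).
  rewrite (Csum_ext _ (fun k => a k * z ^ k)%C)
    by (intros k _; unfold z; rewrite Cpow_mult_l; ring).
  assert (T := Cmod_triangle_inv (Csum (fun k => a k * z ^ k)%C (L * N)) (f z)).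
  replace (f z - _)%C with (- (Csum (fun k => a k * z ^ k) (L * N) - f z))%C in Hk0 by ring.
  rewrite Cmod_opp in Hk0. lra. }
assert (B3 : c / 2 <= Cmod (Csum (fun l => a (l * N + m)%nat * RtoC r ^ (l * N + m))%C L)).
{ set (b := fun k => (a k * RtoC r ^ k)%C).
  assert (Sp : Csum (fun l => b (l * N + m)%nat) L =
    (b m - - Csum (fun l => b (Datatypes.S l * N + m)%nat) k0)%C).
  { unfold L. clear. induction k0 as [|k IH]; [simpl; ring|].
    change (Csum (fun l => b (l * N + m)%nat) (Datatypes.S (Datatypes.S k)))
      with (Csum (fun l => b (l * N + m)%nat) (Datatypes.S k) + b (Datatypes.S k * N + m)%nat)%C.
    rewrite IH.
    change (Csum (fun l => b (Datatypes.S l * N + m)%nat) (Datatypes.S k))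
      with (Csum (fun l => b (Datatypes.S l * N + m)%nat) k + b (Datatypes.S k * N + m)%nat)%C.
    ring. }
  change (c / 2 <= Cmod (Csum (fun l => b (l * N + m)%nat) L)). rewrite Sp.
  eapply Rle_trans; [|apply Cmod_triangle_inv]. rewrite Cmod_opp.
  assert (bm : c <= Cmod (b m)).
  { unfold b, c. rewrite Cmod_mult, Cmod_pow, Cmod_R, Rabs_right by lra.
    apply Rmult_le_compat_l; [apply Cmod_ge_0|]. apply pow_incr; lra. }
  assert (T : Cmod (Csum (fun l => b (Datatypes.S l * N + m)%nat) k0) <= c / 2); [|lra].
  eapply Rle_trans; [apply Cmod_Csum_le|].
  (* Weighted AM-GM: the squares sum to at most [c ^ 2 / 4] and the geometric series to at most 1,
     so each half contributes at most [c / 4]. *)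
  apply Rle_trans with (Rsum (fun l => / c * Cmod (a (N + (l * N + m))%nat) ^ 2
                                      + c / 4 * (r ^ (2 * N)) ^ Datatypes.S l) k0).
  - apply Rsum_le; intros l _.
    replace (Datatypes.S l * N + m)%nat with (N + (l * N + m))%nat by lia.
    unfold b. rewrite Cmod_mult, Cmod_pow, Cmod_R, Rabs_right by lra.
    set (k := (N + (l * N + m))%nat). set (A := Cmod (a k)).
    assert (q1 : (r ^ k) ^ 2 <= (r ^ (2 * N)) ^ Datatypes.S l).
    { rewrite <- !pow_mult.
      replace (k * 2)%nat with (2 * N * Datatypes.S l + 2 * m)%nat by (unfold k; lia).
      rewrite pow_add. rewrite <- (Rmult_1_r (r ^ (2 * N * _))) at 2.
      apply Rmult_le_compat_l; [apply pow_le; lra|].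
      rewrite <- (pow1 (2 * m)). apply pow_incr; lra. }
    apply Rle_trans with (/ c * A ^ 2 + c / 4 * (r ^ k) ^ 2).
    + assert (E : / c * A ^ 2 + c / 4 * (r ^ k) ^ 2 - A * r ^ k = / c * (A - c / 2 * r ^ k) ^ 2)
        by (field; lra).
      assert (0 <= / c * (A - c / 2 * r ^ k) ^ 2).
      { apply Rmult_le_pos; [left; now apply Rinv_0_lt_compat|apply pow2_ge_0]. }
      lra.
    + apply Rplus_le_compat_l, Rmult_le_compat_l; [lra|easy].
  - rewrite Rsum_plus, !Rsum_scal_l.
    assert (G : Rsum (fun l => (r ^ (2 * N)) ^ Datatypes.S l) k0 <= 1).
    { apply Rsum_geometric_le; split; [apply pow_le; lra|easy]. }
    assert (T : Rsum (fun l => Cmod (a (N + (l * N + m))%nat) ^ 2) k0 <= c ^ 2 / 4).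
    { eapply Rle_trans.
      - apply (Rsum_subsample (fun k => Cmod (a (N + k)%nat) ^ 2) N m k0); [|easy].
        intros k; apply pow2_ge_0.
      - assert (E := Rsum_add (fun k => Cmod (a k) ^ 2) N (k0 * N)). fold S in E.
        assert (H1 := Hn0 (N + k0 * N)%nat).
        assert (H2 : S n0 <= S N) by (apply Rsum_incr; [intros; apply pow2_ge_0|lia]).
        lra. }
    assert (/ c * (c ^ 2 / 4) = c / 4) by (field; lra).
    assert (0 < / c) by now apply Rinv_0_lt_compat.
    nra. }
nra.
Qed.

(** * The dyadic lattice *)

(** The shift keeps every value in [(0, 1/2]], inside the range where [rho] is controlled, and keeps
    the radii [1 - dyadic n] at least 1/2. *)
Definition dyadic (n : nat) : R := (1 / 2) ^ S n.

Lemma dyadic_S (n : nat) : dyadic (S n) = dyadic n / 2.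
Proof. unfold dyadic; simpl; field. Qed.

Lemma dyadic_bounds (n : nat) : 0 < dyadic n <= 1 / 2.
Proof.
induction n as [|n IH]; [unfold dyadic; simpl; lra|]. rewrite dyadic_S; lra.
Qed.

Lemma dyadic_le (n m : nat) : (n <= m)%nat -> dyadic m <= dyadic n.
Proof.
induction 1 as [|m _ IH]; [lra|]. pose proof (dyadic_bounds m). rewrite dyadic_S; lra.
Qed.

Lemma dyadic_pow2 (n : nat) : 2 * 2 ^ n * dyadic n = 1.
Proof.
unfold dyadic. induction n as [|n IH]; simpl in *; lra.
Qed.

Lemma dyadic_small (eps : R) : 0 < eps -> exists n, dyadic n < eps.
Proof.
intros He. destruct (pow_lt_1_zero (1 / 2)) with (y := eps) as [N HN]; [rewrite Rabs_right; lra|lra|].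
exists N. specialize (HN (S N) ltac:(lia)).
rewrite Rabs_right in HN; [easy|]. apply Rle_ge, pow_le; lra.
Qed.

Lemma INR_pow2 (n : nat) : INR (2 ^ n) = 2 ^ n.
Proof. rewrite pow_INR; easy. Qed.

(** * Comparison of the integral with a dyadic sum *)

Section Weight.

Variable theta : R -> R.
Hypothesis rho_continuous : forall t : R, 0 < t < 1 -> continuous (rho theta) t.
Hypothesis rho_monotone :
  forall s t : R, 0 < s -> s <= t -> t < 1 -> rho theta s <= rho theta t.

Lemma rho_pos (t : R) : 0 < t -> 0 < rho theta t.
Proof. intros Ht; apply Rmult_lt_0_compat; [easy|apply exp_pos]. Qed.

Lemma weight_ex_RInt (a b : R) : 0 < a -> a <= b -> b < 1 ->
  ex_RInt (fun t => rho theta t / t ^ 2) a b.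
Proof.
intros Ha Hab Hb. apply (@ex_RInt_continuous R_CompleteNormedModule).
intros t; rewrite Rmin_left, Rmax_right by lra; intros Ht.
apply (continuous_mult (rho theta) (fun t => / t ^ 2)); [apply rho_continuous; lra|].
apply (ex_derive_continuous (K := R_AbsRing) (V := R_NormedModule)).
auto_derive. nra.
Qed.

Lemma weight_RInt_Chasles (a b c : R) : 0 < a -> a <= b -> b <= c -> c < 1 ->
  RInt (fun t => rho theta t / t ^ 2) a c
  = RInt (fun t => rho theta t / t ^ 2) a b + RInt (fun t => rho theta t / t ^ 2) b c.
Proof.
intros; symmetry.
apply (RInt_Chasles (V := R_CompleteNormedModule)); apply weight_ex_RInt; lra.
Qed.

Lemma weight_RInt_bounds (a b m M : R) : 0 < a -> a <= b -> b < 1 ->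
  (forall t, a <= t <= b -> m <= rho theta t / t ^ 2 <= M) ->
  m * (b - a) <= RInt (fun t => rho theta t / t ^ 2) a b <= M * (b - a).
Proof.
intros Ha Hab Hb H.
assert (C : forall k, RInt (fun _ => k) a b = k * (b - a)).
{ intros k; rewrite (RInt_const (V := R_CompleteNormedModule)); apply Rmult_comm. }
split; rewrite <- C; (apply RInt_le; [easy|..]);
  try apply ex_RInt_const; try (apply weight_ex_RInt; lra); intros t Ht; apply H; lra.
Qed.

(** For [h = dyadic n] the interval has length [h / 2] and [2 ^ n = 1 / (2 * h)]. Monotonicity puts
    the integrand between [rho (h / 2) / h ^ 2] and [rho h / (h / 2) ^ 2]; the latter produces the
    4. *)
Lemma weight_dyadic_step (n : nat) :
  2 ^ n * rho theta (dyadic (S n))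
    <= RInt (fun t => rho theta t / t ^ 2) (dyadic (S n)) (dyadic n)
    <= 4 * (2 ^ n * rho theta (dyadic n)).
Proof.
assert (H := dyadic_bounds n). assert (P := dyadic_pow2 n).
assert (Hp : 2 ^ n = / (2 * dyadic n)) by (apply Rmult_eq_reg_r with (2 * dyadic n);
  [rewrite Rinv_l|]; lra).
rewrite Hp, dyadic_S. set (h := dyadic n) in *.
replace (/ (2 * h) * rho theta (h / 2)) with (rho theta (h / 2) / h ^ 2 * (h - h / 2))
  by (field; lra).
replace (4 * (/ (2 * h) * rho theta h)) with (rho theta h / (h / 2) ^ 2 * (h - h / 2))
  by (field; lra).
apply weight_RInt_bounds; try lra.
intros t Ht.
assert (r1 := rho_monotone (h / 2) t ltac:(lra) ltac:(lra) ltac:(lra)).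
assert (r2 := rho_monotone t h ltac:(lra) ltac:(lra) ltac:(lra)).
assert (r0 := rho_pos (h / 2) ltac:(lra)).
assert (t2 : 0 < t ^ 2) by (apply pow_lt; lra).
assert (q2 : 0 < (h / 2) ^ 2) by (apply pow_lt; lra).
split; apply Rmult_le_compat; try lra.
- left; apply Rinv_0_lt_compat, pow_lt; lra.
- apply Rinv_le_contravar; [easy|]. apply pow_incr; lra.
- left; now apply Rinv_0_lt_compat.
- apply Rinv_le_contravar; [easy|]. apply pow_incr; lra.
Qed.

Lemma weight_dyadic_sum (m k : nat) :
  Rsum (fun i => 2 ^ (m + i) * rho theta (dyadic (S (m + i)))) k
    <= RInt (fun t => rho theta t / t ^ 2) (dyadic (m + k)) (dyadic m)
    <= Rsum (fun i => 4 * (2 ^ (m + i) * rho theta (dyadic (m + i)))) k.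
Proof.
induction k as [|k IH].
- rewrite Nat.add_0_r, (RInt_point (V := R_CompleteNormedModule)); unfold zero; simpl; lra.
- rewrite Nat.add_succ_r.
  assert (S := weight_dyadic_step (m + k)).
  assert (L : dyadic (m + k) <= dyadic m) by (apply dyadic_le; lia).
  assert (L' : dyadic (Datatypes.S (m + k)) <= dyadic (m + k)) by (apply dyadic_le; lia).
  pose proof (dyadic_bounds (Datatypes.S (m + k))). pose proof (dyadic_bounds m).
  rewrite (weight_RInt_Chasles _ (dyadic (m + k))) by lra.
  change (Rsum ?f (Datatypes.S k)) with (Rsum f k + f k). cbv beta. lra.
Qed.

End Weight.

(** * Pseudohyperbolic separation and the lattice *)

Lemma one_minus_conj_mult_neq_0 (a b : C) : in_disc a -> in_disc b ->
  (RtoC 1 - Cconj a * b)%C <> 0%C.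
Proof.
intros Ha Hb H.
assert (E : Cmod (Cconj a * b) = 1).
{ rewrite <- Cmod_1. f_equal. rewrite <- (Cplus_0_r (Cconj a * b)), <- H. ring. }
rewrite Cmod_mult, Cmod_conj in E. unfold in_disc in *.
pose proof (Cmod_ge_0 a); pose proof (Cmod_ge_0 b). nra.
Qed.

(** Writing [1 - conj a * b] as [(1 - |a| ^ 2) + conj a * (a - b)] bounds the denominator by
    [2 * (1 - |a|) + |a - b|]. *)
Lemma pseudo_hyp_dist_lower_bound (c : R) (a b : C) :
  0 < c -> in_disc a -> in_disc b -> c * (1 - Cmod a) <= Cmod (a - b) ->
  c / (2 + c) <= pseudo_hyp_dist a b.
Proof.
intros Hc Ha Hb H.
assert (N := one_minus_conj_mult_neq_0 a b Ha Hb).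
unfold pseudo_hyp_dist. rewrite Cmod_div by exact N.
apply Cmod_gt_0 in N.
assert (U : Cmod (RtoC 1 - Cconj a * b) <= 2 * (1 - Cmod a) + Cmod (a - b)).
{ replace (RtoC 1 - Cconj a * b)%C with (RtoC (1 - Cmod a ^ 2) + Cconj a * (a - b))%C.
  - eapply Rle_trans; [apply Cmod_triangle|].
    rewrite Cmod_mult, Cmod_conj, Cmod_R.
    unfold in_disc in Ha. pose proof (Cmod_ge_0 a). pose proof (Cmod_ge_0 (a - b)).
    rewrite Rabs_right by nra. nra.
  - rewrite RtoC_minus, Cmod2_conj; ring. }
apply Rmult_le_reg_r with ((2 + c) * Cmod (RtoC 1 - Cconj a * b)); [nra|].
replace (c / (2 + c) * _) with (c * Cmod (RtoC 1 - Cconj a * b)) by (field; lra).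
replace (Cmod (a - b) / _ * _) with ((2 + c) * Cmod (a - b)) by (field; lra).
nra.
Qed.

(** The powers of [q] sum to zero, so the numbers [1 - q ^ k] for [k < n] add up to [n], while each
    has modulus at most [n * |1 - q|]. No estimate of the sine is involved. *)
Lemma root_chord_lower_bound (q : C) (n : nat) :
  (0 < n)%nat -> Cmod q = 1 -> (q ^ n)%C = 1%C -> q <> 1%C -> 1 <= INR n * Cmod (1 - q).
Proof.
intros Hn q1 qn Hq.
assert (A : forall k, Cmod (1 - q ^ k) <= INR k * Cmod (1 - q)).
{ induction k as [|k IH].
  - simpl. replace (1 - 1)%C with (RtoC 0) by ring. rewrite Cmod_0; lra.
  - rewrite S_INR. replace (1 - q ^ S k)%C with ((1 - q ^ k) + q ^ k * (1 - q))%C by (simpl; ring).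
    eapply Rle_trans; [apply Cmod_triangle|].
    rewrite Cmod_mult, Cmod_pow, q1, pow1. lra. }
assert (n0 : 0 < INR n) by now apply lt_0_INR.
apply Rmult_le_reg_l with (INR n); [easy|].
rewrite Rmult_1_r. rewrite <- (Rsum_const (INR n * Cmod (1 - q)) n).
eapply Rle_trans with (Cmod (Csum (fun k => 1 - q ^ k)%C n)).
- rewrite Csum_minus, Csum_root_zero, Csum_const by easy.
  replace (INR n * 1 - 0)%C with (RtoC (INR n)) by ring.
  rewrite Cmod_R, Rabs_right; lra.
- eapply Rle_trans; [apply Cmod_Csum_le|]. apply Rsum_le; intros k Hk.
  eapply Rle_trans; [apply A|]. apply Rmult_le_compat_r; [apply Cmod_ge_0|].
  apply le_INR; lia.
Qed.

Definition lattice_level (k : nat) : nat := Nat.log2 (S k).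

Definition lattice_root (n : nat) : C := expi (/ INR (2 ^ n)).

(* Level [n] consists of the [2 ^ n] indices [2 ^ n - 1 <= k < 2 ^ (n + 1) - 1]. *)
Definition lattice (k : nat) : C :=
  let n := lattice_level k in
  (RtoC (1 - dyadic n) * lattice_root n ^ (S k - 2 ^ n))%C.

Lemma pow2_pos (n : nat) : (0 < 2 ^ n)%nat.
Proof. pose proof (Nat.pow_nonzero 2 n); lia. Qed.

Lemma lattice_root_primitive (n : nat) : primitive_root (2 ^ n) (lattice_root n).
Proof. apply primitive_root_expi, pow2_pos. Qed.

Lemma Cmod_lattice (k : nat) : Cmod (lattice k) = 1 - dyadic (lattice_level k).
Proof.
unfold lattice. pose proof (dyadic_bounds (lattice_level k)).
destruct (lattice_root_primitive (lattice_level k)) as (_ & H1 & _).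
rewrite Cmod_mult, Cmod_pow, H1, pow1, Cmod_R, Rabs_right; lra.
Qed.

Lemma lattice_level_block (n j : nat) : (j < 2 ^ n)%nat ->
  lattice_level (2 ^ n - 1 + j) = n.
Proof.
intros Hj. assert (P := pow2_pos n).
unfold lattice_level. apply Nat.log2_unique; [lia|].
rewrite Nat.pow_succ_r'; lia.
Qed.

Lemma lattice_block (n j : nat) : (j < 2 ^ n)%nat ->
  lattice (2 ^ n - 1 + j) = (RtoC (1 - dyadic n) * lattice_root n ^ j)%C.
Proof.
intros Hj. assert (P := pow2_pos n).
unfold lattice; rewrite lattice_level_block by easy. do 2 f_equal. lia.
Qed.

Lemma lattice_disc_seq : disc_seq lattice.
Proof.
split.
- intros k; unfold in_disc; rewrite Cmod_lattice.
  pose proof (dyadic_bounds (lattice_level k)); lra.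
- apply is_lim_seq_spec; intros eps.
  destruct (dyadic_small eps (cond_pos eps)) as [n Hn].
  exists (2 ^ n)%nat; intros k Hk.
  rewrite Cmod_lattice.
  assert (L : (n <= lattice_level k)%nat).
  { unfold lattice_level. rewrite <- (Nat.log2_pow2 n) by lia. apply Nat.log2_le_mono; lia. }
  assert (D := dyadic_le _ _ L). pose proof (dyadic_bounds (lattice_level k)).
  rewrite Rabs_left; lra.
Qed.

(** Across levels the radii alone are far enough apart, since [dyadic] halves at each level. Within
    a level the chord between two roots of unity is at least [dyadic n], and the radius, at least
    1/2, supplies the factor. *)
Lemma lattice_spacing (k l : nat) : k <> l ->
  1 / 2 * (1 - Cmod (lattice k)) <= Cmod (lattice k - lattice l).
Proof.
intros Hkl.
assert (Hk := dyadic_bounds (lattice_level k)).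
assert (Hl := dyadic_bounds (lattice_level l)).
destruct (Nat.lt_total (lattice_level k) (lattice_level l)) as [L|[L|L]].
- assert (D := dyadic_le _ _ L). rewrite dyadic_S in D.
  replace (lattice k - lattice l)%C with (- (lattice l - lattice k))%C by ring.
  rewrite Cmod_opp. eapply Rle_trans; [|apply Cmod_triangle_inv].
  rewrite !Cmod_lattice; lra.
- rewrite Cmod_lattice.
  unfold lattice. rewrite <- L. set (n := lattice_level k) in *.
  destruct (lattice_root_primitive n) as (_ & w1 & wN & wd).
  assert (B : forall i, lattice_level i = n -> (2 ^ n <= S i < 2 * 2 ^ n)%nat).
  { intros i <-. unfold lattice_level. rewrite <- Nat.pow_succ_r'.
    apply Nat.log2_spec; lia. }
  assert (Bk := B k eq_refl). assert (Bl := B l (eq_sym L)).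
  set (w := lattice_root n) in *.
  assert (C : forall i d, (0 < d < 2 ^ n)%nat -> dyadic n <= Cmod (w ^ i - w ^ (i + d))).
  { intros i d Hd.
    assert (A := root_chord_lower_bound (w ^ d) (2 ^ n) (pow2_pos n)).
    rewrite Cmod_pow, w1, pow1, <- Cpow_mult_r, (Nat.mul_comm d), Cpow_mult_r, wN, Cpow_1_l in A.
    specialize (A eq_refl eq_refl (wd d Hd)).
    replace (w ^ i - w ^ (i + d))%C with (w ^ i * (1 - w ^ d))%C by (rewrite Cpow_add_r; ring).
    rewrite Cmod_mult, Cmod_pow, w1, pow1, Rmult_1_l.
    rewrite INR_pow2 in A. assert (P := dyadic_pow2 n).
    assert (0 < 2 ^ n) by (apply pow_lt; lra).
    apply Rmult_le_reg_l with (2 ^ n); [easy|]. lra. }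
  replace (_ - _)%C with (RtoC (1 - dyadic n) * (w ^ (S k - 2 ^ n) - w ^ (S l - 2 ^ n)))%C by ring.
  rewrite Cmod_mult, Cmod_R, Rabs_right by lra.
  assert (D : dyadic n <= Cmod (w ^ (S k - 2 ^ n) - w ^ (S l - 2 ^ n))).
  { destruct (Nat.lt_total k l) as [K|[K|K]]; [|easy|].
    - replace (S l - 2 ^ n)%nat with (S k - 2 ^ n + (l - k))%nat by lia. apply C; lia.
    - replace (S k - 2 ^ n)%nat with (S l - 2 ^ n + (k - l))%nat by lia.
      rewrite <- Cmod_opp. replace (- _)%C with (w ^ (S l - 2 ^ n) - w ^ (S l - 2 ^ n + (k - l)))%C by ring.
      apply C; lia. }
  nra.
- assert (D := dyadic_le _ _ L). rewrite dyadic_S in D.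
  eapply Rle_trans; [|apply Cmod_triangle_inv].
  rewrite !Cmod_lattice; lra.
Qed.

Lemma lattice_separated : separated lattice.
Proof.
unfold separated.
apply Rbar_lt_le_trans with (Finite (1 / 2 / (2 + 1 / 2))); [simpl; lra|].
apply Glb_Rbar_correct. intros d (k & l & Hkl & ->). simpl.
apply pseudo_hyp_dist_lower_bound; [lra|apply lattice_disc_seq|apply lattice_disc_seq|].
now apply lattice_spacing.
Qed.

(** The exponent is exactly [1 / h], so [(1 - h) ^ m * (1 + m * h) <= 1] at [m = 1 / h] gives
    1/2. *)
Lemma lattice_radius_pow (n : nat) : (1 - dyadic n) ^ (2 * 2 ^ n) <= 1 / 2.
Proof.
assert (P := dyadic_pow2 n). assert (H := dyadic_bounds n).
set (h := dyadic n) in *.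
assert (B : forall m, (1 - h) ^ m * (1 + INR m * h) <= 1).
{ induction m as [|m IH]; [simpl; lra|].
  rewrite S_INR; simpl. assert (0 <= (1 - h) ^ m) by (apply pow_le; lra).
  pose proof (pos_INR m).
  apply Rle_trans with ((1 - h) ^ m * (1 + INR m * h)); [|easy].
  replace ((1 - h) * (1 - h) ^ m * (1 + (INR m + 1) * h))
    with ((1 - h) ^ m * ((1 - h) * (1 + (INR m + 1) * h))) by ring.
  apply Rmult_le_compat_l; [easy|]. nra. }
specialize (B (2 * 2 ^ n)%nat).
rewrite mult_INR, INR_pow2 in B. replace (INR 2) with 2 in B by (simpl; ring). rewrite P in B. lra.
Qed.

Lemma Rsum_lattice_blocks (F : nat -> R) (n k : nat) :
  Rsum F (2 ^ (n + k) - 1)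
  = Rsum F (2 ^ n - 1) + Rsum (fun i => Rsum (fun j => F (2 ^ (n + i) - 1 + j)%nat) (2 ^ (n + i))) k.
Proof.
induction k as [|k IH]; [rewrite Nat.add_0_r; simpl; ring|].
rewrite Nat.add_succ_r. pose proof (pow2_pos (n + k)).
replace (2 ^ S (n + k) - 1)%nat with (2 ^ (n + k) - 1 + 2 ^ (n + k))%nat
  by (rewrite Nat.pow_succ_r'; lia).
rewrite Rsum_add, IH. simpl; ring.
Qed.

Lemma sum_n_Rsum (F : nat -> R) (n : nat) : sum_n F n = Rsum F (S n).
Proof.
induction n as [|n IH]; [rewrite sum_O; simpl; ring|].
rewrite sum_Sn, IH. reflexivity.
Qed.

Lemma ex_series_Rsum_bounded (F : nat -> R) :
  (forall k, 0 <= F k) -> ex_series F -> exists B, forall n, Rsum F n <= B.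
Proof.
intros HF [l Hl]. exists l; intros n.
eapply Rle_trans; [apply (Rsum_incr F n (S n) HF); lia|].
rewrite <- sum_n_Rsum.
apply (is_lim_seq_incr_compare (sum_n F)); [exact Hl|].
intros k; rewrite !sum_n_Rsum. simpl; specialize (HF (S k)); lra.
Qed.

(** * Divergence along the lattice *)

Lemma lattice_thick (theta : R -> R) :
  (forall t : R, 0 < t < 1 -> continuous (rho theta) t) ->
  (forall s t : R, 0 < s -> s <= t -> t < 1 -> rho theta s <= rho theta t) ->
  int_at_0_infinite (fun t : R => rho theta t / t ^ 2) -> thick theta lattice.
Proof.
intros Hc Hm [eps0 [Heps0 Hint]] [f [[Hf [M HM]] [Hnz Hs]]].
set (F := fun k => _) in Hs.
assert (HF : forall k, F k = rho theta (dyadic (lattice_level k)) * Cmod (f (lattice k))).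
{ intros k; unfold F. pose proof (dyadic_bounds (lattice_level k)).
  destruct (Ceq_dec (lattice k) 0) as [E|_].
  - exfalso. apply (f_equal Cmod) in E. rewrite Cmod_lattice, Cmod_0 in E. lra.
  - rewrite Cmod_lattice. do 2 f_equal; ring. }
assert (F0 : forall k, 0 <= F k).
{ intros k; rewrite HF. apply Rmult_le_pos; [|apply Cmod_ge_0].
  left; apply rho_pos, dyadic_bounds. }
destruct (ex_series_Rsum_bounded F F0 Hs) as [B HB].
assert (Hh : holomorphic_on_disc f).
{ intros z Hz; now apply ex_derive_complex_derivative, Hf. }
destruct (sample_mean_lower_bound f M Hh HM Hnz) as (c & N0 & c0 & Hmean).
(* The first bound makes [dyadic m] an admissible endpoint of the divergent integral; the second
   forces [2 ^ m >= N0], because [2 ^ m = 1 / (2 * dyadic m)]. *)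
destruct (dyadic_small (Rmin eps0 (/ (2 * (INR N0 + 1))))) as [m Hm0].
{ apply Rmin_pos; [lra|]. apply Rinv_0_lt_compat. pose proof (pos_INR N0); lra. }
assert (m1 : dyadic m < eps0) by (eapply Rlt_le_trans; [exact Hm0|apply Rmin_l]).
assert (m2 : (N0 <= 2 ^ m)%nat).
{ apply INR_le. rewrite INR_pow2. assert (P := dyadic_pow2 m).
  assert (E := Rlt_le_trans _ _ _ Hm0 (Rmin_r _ _)).
  pose proof (pos_INR N0). pose proof (dyadic_bounds m).
  assert (A : dyadic m * (2 * (INR N0 + 1)) < 1).
  { apply Rmult_lt_reg_r with (/ (2 * (INR N0 + 1))); [apply Rinv_0_lt_compat; lra|].
    rewrite Rmult_assoc, Rinv_r by lra. lra. }
  apply Rnot_lt_le; intros L. nra. }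
assert (blk : forall i, c * (2 ^ (m + i) * rho theta (dyadic (m + i)))
  <= Rsum (fun j => F (2 ^ (m + i) - 1 + j)%nat) (2 ^ (m + i))).
{ intros i. set (n := (m + i)%nat).
  assert (Pn : (2 ^ m <= 2 ^ n)%nat) by (apply Nat.pow_le_mono_r; unfold n; lia).
  pose proof (dyadic_bounds n).
  assert (A := Hmean (2 ^ n)%nat (lattice_root n) (1 - dyadic n) ltac:(lia)
    (lattice_root_primitive n) ltac:(lra) (lattice_radius_pow n)).
  rewrite (Rsum_ext _ (fun j => rho theta (dyadic n)
     * Cmod (f ((1 - dyadic n) * lattice_root n ^ j)%C))).
  - rewrite Rsum_scal_l. rewrite INR_pow2 in A.
    assert (R0 := rho_pos theta (dyadic n) ltac:(lra)).
    rewrite RtoC_minus in A. nra.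
  - intros j Hj. now rewrite HF, lattice_level_block, lattice_block, RtoC_minus. }
(* A convergent series would bound the block sums, hence the integrals uniformly in the lower
   endpoint. *)
assert (U : forall k, RInt (fun t => rho theta t / t ^ 2) (dyadic (m + k)) (dyadic m) <= 4 * (B / c)).
{ intros k. eapply Rle_trans; [apply (weight_dyadic_sum theta Hc Hm)|].
  rewrite Rsum_scal_l. apply Rmult_le_compat_l; [lra|].
  apply Rmult_le_reg_l with c; [easy|].
  rewrite <- Rsum_scal_l. replace (c * (B / c)) with B by (field; lra).
  eapply Rle_trans; [apply Rsum_le; intros i _; apply blk|].
  assert (A := Rsum_lattice_blocks F m k). assert (A2 := HB (2 ^ (m + k) - 1)%nat).
  assert (A3 := Rsum_nonneg F (2 ^ m - 1) F0). lra. }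
pose proof (dyadic_bounds m).
specialize (Hint (dyadic m) ltac:(lra) (fun x => 4 * (B / c) < x)).
destruct Hint as [d Hd]; [now exists (4 * (B / c))|].
destruct (dyadic_small d (cond_pos d)) as [n Hn].
specialize (Hd (dyadic (m + n))).
pose proof (dyadic_bounds (m + n)).
assert (L : dyadic (m + n) <= dyadic n) by (apply dyadic_le; lia).
specialize (U n).
cut (4 * (B / c) < RInt (fun t => rho theta t / t ^ 2) (dyadic (m + n)) (dyadic m)); [lra|].
apply Hd; [|lra].
unfold ball; simpl; unfold AbsRing_ball, abs, minus, plus, opp; simpl.
rewrite Rabs_right; lra.
Qed.

(** * Counting separated points *)

Definition list_sum {A : Type} (w : A -> R) (l : list A) : R :=
  fold_right (fun c s => w c + s) 0 l.

Lemma list_sum_app {A : Type} (w : A -> R) (l m : list A) :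
  list_sum w (l ++ m) = list_sum w l + list_sum w m.
Proof. induction l as [|c l IH]; simpl; [|rewrite IH]; ring. Qed.

Lemma list_sum_const {A : Type} (w : A -> R) (x : R) (l : list A) :
  (forall c, In c l -> w c = x) -> list_sum w l = INR (length l) * x.
Proof.
induction l as [|c l IH]; intros H; [simpl; ring|].
change (list_sum w (c :: l)) with (w c + list_sum w l).
change (length (c :: l)) with (S (length l)).
rewrite IH, (H c), S_INR; [ring|now left|]. intros c' Hc'; apply H; now right.
Qed.

Lemma list_sum_incl {A : Type} (w : A -> R) (l m : list A) :
  (forall c, 0 <= w c) -> NoDup l -> incl l m -> list_sum w l <= list_sum w m.
Proof.
intros Hw Hl; revert m; induction Hl as [|c l Hc Hl IH]; intros m Hm.
- simpl. clear Hm; induction m as [|c m IHm]; simpl; [lra|]. specialize (Hw c); lra.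
- destruct (in_split c m) as (m1 & m2 & ->); [apply Hm; now left|].
  rewrite list_sum_app; simpl.
  assert (H := IH (m1 ++ m2)). rewrite list_sum_app in H.
  assert (incl l (m1 ++ m2)); [|specialize (H H0); lra].
  intros x Hx. assert (Hx' := Hm x (or_intror Hx)).
  apply in_app_or in Hx'; apply in_or_app.
  destruct Hx' as [?|[->|?]]; [now left|easy|now right].
Qed.

(** A weighted pigeonhole principle: the chosen cells form a duplicate-free list inside [cells]. The
    induction remembers that each chosen cell belongs to an earlier index, so a new index cannot
    reuse it. *)
Lemma Rsum_le_list_sum {A : Type} (F : nat -> R) (w : A -> R) (P : nat -> A -> Prop)
    (cells : list A) (n : nat) :
  (forall c, 0 <= w c) ->
  (forall k l c, P k c -> P l c -> k = l) ->
  (forall k, (k < n)%nat -> exists c, P k c /\ In c cells /\ F k <= w c) ->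
  Rsum F n <= list_sum w cells.
Proof.
intros Hw HP H.
assert (K : exists l, NoDup l /\ incl l cells /\ Rsum F n <= list_sum w l /\
  forall c, In c l -> exists k, (k < n)%nat /\ P k c).
{ induction n as [|n IH].
  - exists nil; repeat split; [constructor|easy|simpl; lra|easy].
  - destruct IH as (l & Nl & Il & Sl & Pl); [intros k Hk; apply H; lia|].
    destruct (H n (Nat.lt_succ_diag_r n)) as (c & Pc & Ic & Fc).
    exists (c :: l); repeat split.
    + constructor; [|easy]. intros Hc.
      destruct (Pl c Hc) as (k & Hk & Pk). assert (E := HP _ _ _ Pk Pc); lia.
    + intros x [<-|Hx]; [easy|now apply Il].
    + simpl; lra.
    + intros x [<-|Hx]; [exists n; split; [lia|easy]|].
      destruct (Pl x Hx) as (k & Hk & Pk); exists k; split; [lia|easy]. }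
destruct K as (l & Nl & Il & Sl & _).
eapply Rle_trans; [exact Sl|]. now apply list_sum_incl.
Qed.

Lemma dyadic_level_exists (x : R) (m n : nat) : dyadic n < x -> x <= dyadic m ->
  exists i, (m <= i < n)%nat /\ dyadic (S i) < x <= dyadic i.
Proof.
intros Hn Hm.
assert (mn : (m < n)%nat).
{ apply Nat.nle_gt; intros L. apply dyadic_le in L; lra. }
induction mn as [|n mn IH].
- exists m; split; [lia|easy].
- destruct (Rle_lt_dec x (dyadic n)) as [L|L].
  + exists n; split; [lia|easy].
  + destruct (IH L) as (i & Hi & Hx). exists i; split; [lia|easy].
Qed.

Definition swap_coordinates (z : C) : bool :=
  if Rle_dec (Rabs (Im z)) (Rabs (Re z)) then false else true.

Definition small_coordinate (z : C) : R := if swap_coordinates z then Re z else Im z.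

Definition large_coordinate (z : C) : R := if swap_coordinates z then Im z else Re z.

Definition large_coordinate_nonneg (z : C) : bool :=
  if Rle_dec 0 (large_coordinate z) then true else false.

Lemma coordinates_Cmod2 (z : C) :
  Cmod z ^ 2 = small_coordinate z ^ 2 + large_coordinate z ^ 2.
Proof.
rewrite Cmod2_alt. unfold small_coordinate, large_coordinate.
destruct (swap_coordinates z); ring.
Qed.

Lemma small_coordinate_le (z : C) : small_coordinate z ^ 2 <= large_coordinate z ^ 2.
Proof.
unfold small_coordinate, large_coordinate, swap_coordinates.
destruct (Rle_dec _ _); rewrite <- (pow2_abs (Re z)), <- (pow2_abs (Im z));
  (apply pow_incr; split; [apply Rabs_pos|lra]).
Qed.

Lemma small_coordinate_bound (z : C) : Cmod z < 1 -> -1 <= small_coordinate z <= 1.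
Proof.
intros H. apply Rabs_le_between. unfold small_coordinate.
pose proof (re_le_Cmod z). pose proof (im_le_Cmod z).
destruct (swap_coordinates z); lra.
Qed.

(* Near the unit circle the larger coordinate is determined, with Lipschitz
   dependence, by its sign, the smaller coordinate and the modulus. *)
Lemma cell_diameter (z w : C) (mu : R) :
  1 / 2 <= Cmod z <= 1 -> 1 / 2 <= Cmod w <= 1 ->
  swap_coordinates z = swap_coordinates w ->
  large_coordinate_nonneg z = large_coordinate_nonneg w ->
  Rabs (small_coordinate z - small_coordinate w) <= mu ->
  Rabs (Cmod z - Cmod w) <= mu ->
  Cmod (z - w) <= 7 * mu.
Proof.
intros Hz Hw Hs Hp Hsm Hm.
assert (D : Cmod (z - w) <= Rabs (small_coordinate z - small_coordinate w)
   + Rabs (large_coordinate z - large_coordinate w)).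
{ eapply Rle_trans; [apply Cmod_le_re_im|].
  unfold small_coordinate, large_coordinate; rewrite <- Hs.
  destruct (swap_coordinates z); unfold Re, Im, Rminus; simpl; lra. }
cut (Rabs (large_coordinate z - large_coordinate w) <= 6 * mu); [lra|].
assert (Ez := coordinates_Cmod2 z). assert (Ew := coordinates_Cmod2 w).
assert (Lz := small_coordinate_le z). assert (Lw := small_coordinate_le w).
unfold large_coordinate_nonneg in Hp.
set (a := small_coordinate z) in *. set (b := small_coordinate w) in *.
set (x := large_coordinate z) in *. set (y := large_coordinate w) in *.
set (r := Cmod z) in *. set (s := Cmod w) in *.
assert (mu0 : 0 <= mu) by (eapply Rle_trans; [apply Rabs_pos|exact Hm]).
apply Rabs_le_between in Hsm. apply Rabs_le_between in Hm.
(* Here [v ^ 2 >= t ^ 2 / 2 >= 1 / 8 > 1 / 9]. *)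
assert (Big : forall u v t, 1 / 2 <= t -> t ^ 2 = u ^ 2 + v ^ 2 -> u ^ 2 <= v ^ 2 -> 1 / 3 <= Rabs v).
{ intros u v t Ht E1 E2. apply Rnot_lt_le; intros L.
  assert (Rabs v ^ 2 < 1 / 9) by (pose proof (Rabs_pos v); nra).
  rewrite pow2_abs in H. nra. }
assert (Bx := Big _ _ _ (proj1 Hz) Ez Lz). assert (By := Big _ _ _ (proj1 Hw) Ew Lw).
assert (Ba : forall u v t, 0 <= t -> t <= 1 -> t ^ 2 = u ^ 2 + v ^ 2 -> -1 <= u <= 1)
  by (intros; nra).
assert (A1 := Ba a x r ltac:(lra) ltac:(lra) Ez). assert (A2 := Ba b y s ltac:(lra) ltac:(lra) Ew).
(* The difference [x ^ 2 - y ^ 2] is [(r ^ 2 - s ^ 2) - (a ^ 2 - b ^ 2)]. Equal signs give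
   [|x + y| >= 2 / 3], which turns 4 into 6; the small coordinate adds 1. *)
assert (K : -4 * mu <= (x - y) * (x + y) <= 4 * mu).
{ replace ((x - y) * (x + y)) with ((r - s) * (r + s) - (a - b) * (a + b)) by nra.
  assert (- (2 * mu) <= (r - s) * (r + s) <= 2 * mu) by (split; nra).
  assert (- (2 * mu) <= (a - b) * (a + b) <= 2 * mu).
  { destruct (Rle_dec 0 (a + b)); split; nra. }
  lra. }
apply Rabs_le_between.
destruct (Rle_dec 0 x) as [X|X], (Rle_dec 0 y) as [Y|Y]; try discriminate.
- rewrite Rabs_right in Bx, By by lra. split; nra.
- rewrite Rabs_left in Bx, By by lra. split; nra.
Qed.

Lemma same_floor (x y : R) (p : nat) :
  INR p <= x < INR p + 1 -> INR p <= y < INR p + 1 -> Rabs (x - y) <= 1.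
Proof. intros; apply Rabs_le_between; lra. Qed.

Definition cell : Type := nat * ((bool * bool) * (nat * nat)).

(* At level [i] the mesh is [dyadic i / A]. *)
Definition in_cell (A : nat) (z : C) (c : cell) : Prop :=
  let '(i, ((b1, b2), (p, q))) := c in
  dyadic (S i) < 1 - Cmod z <= dyadic i /\
  swap_coordinates z = b1 /\ large_coordinate_nonneg z = b2 /\
  INR p <= (small_coordinate z + 1) / (dyadic i / INR A) < INR p + 1 /\
  INR q <= (1 - Cmod z) / (dyadic i / INR A) < INR q + 1.

(** The small coordinate ranges over an interval of length 2, that is [4 * A * 2 ^ i] meshes, and
    [1 - |z|] over at most [A]. The excess in [5] and in [A + 1] makes room for the end values. *)
Definition level_cells (A i : nat) : list cell :=
  map (pair i) (list_prod (list_prod (true :: false :: nil) (true :: false :: nil))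
                  (list_prod (seq 0 (5 * A * 2 ^ i)) (seq 0 (A + 1)))).

Lemma level_cells_length (A i : nat) :
  length (level_cells A i) = (20 * A * (A + 1) * 2 ^ i)%nat.
Proof. unfold level_cells. rewrite length_map, !length_prod, !length_seq. simpl length. lia. Qed.

(** The 7 of [cell_diameter] doubles because [1 - |z|] exceeds half of [dyadic i]. *)
Lemma in_cell_close (A : nat) (z w : C) (c : cell) : (0 < A)%nat ->
  in_cell A z c -> in_cell A w c -> Cmod (z - w) <= 14 / INR A * (1 - Cmod z).
Proof.
destruct c as [i [[b1 b2] [p q]]]. intros HA (Lz & z1 & z2 & z3 & z4) (Lw & w1 & w2 & w3 & w4).
assert (A0 : 0 < INR A) by now apply lt_0_INR.
pose proof (dyadic_bounds i).
set (mu := dyadic i / INR A) in *.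
assert (mu0 : 0 < mu) by (apply Rdiv_lt_0_compat; lra).
assert (S : forall x y, Rabs (x / mu - y / mu) <= 1 -> Rabs (x - y) <= mu).
{ intros x y K. replace (x - y) with (mu * (x / mu - y / mu)) by (field; lra).
  rewrite Rabs_mult, (Rabs_right mu) by lra. nra. }
assert (s1 := S _ _ (same_floor _ _ _ z3 w3)). assert (s2 := S _ _ (same_floor _ _ _ z4 w4)).
assert (D : Cmod (z - w) <= 7 * mu).
{ rewrite dyadic_S in Lz, Lw.
  apply cell_diameter; try lra; try congruence.
  - now replace (small_coordinate z - small_coordinate w)
      with (small_coordinate z + 1 - (small_coordinate w + 1)) by ring.
  - rewrite Rabs_minus_sym.
    now replace (Cmod w - Cmod z) with (1 - Cmod z - (1 - Cmod w)) by ring. }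
rewrite dyadic_S in Lz.
replace (14 / INR A * (1 - Cmod z)) with (7 * ((2 * (1 - Cmod z)) / INR A)) by (field; lra).
eapply Rle_trans; [exact D|]. apply Rmult_le_compat_l; [lra|].
apply Rmult_le_compat_r; [left; now apply Rinv_0_lt_compat|lra].
Qed.

Lemma in_cell_exists (A : nat) (z : C) (i : nat) : (0 < A)%nat ->
  dyadic (S i) < 1 - Cmod z <= dyadic i ->
  exists c, in_cell A z c /\ In c (level_cells A i).
Proof.
intros HA Hi.
assert (A0 : 0 < INR A) by now apply lt_0_INR.
assert (Pd := dyadic_pow2 i).
pose proof (dyadic_bounds i). pose proof (dyadic_bounds (S i)).
assert (sc := small_coordinate_bound z ltac:(lra)).
set (mu := dyadic i / INR A).
assert (mu0 : 0 < mu) by (apply Rdiv_lt_0_compat; lra).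
assert (imu : 0 < / mu) by now apply Rinv_0_lt_compat.
destruct (nfloor_ex ((small_coordinate z + 1) / mu)) as [p Hp]; [apply Rmult_le_pos; lra|].
destruct (nfloor_ex ((1 - Cmod z) / mu)) as [q Hq]; [apply Rmult_le_pos; lra|].
exists (i, ((swap_coordinates z, large_coordinate_nonneg z), (p, q))).
split; [simpl; now fold mu|].
apply in_map, in_prod; [|apply in_prod].
- apply in_prod; [destruct (swap_coordinates z)|destruct (large_coordinate_nonneg z)]; simpl; tauto.
- apply in_seq; split; [lia|]. apply INR_lt. rewrite Nat.add_0_l, !mult_INR, INR_pow2.
  apply Rle_lt_trans with (2 / mu).
  + eapply Rle_trans; [apply Hp|]. apply Rmult_le_compat_r; lra.
  + replace (2 / mu) with (INR A * (2 * (2 * 2 ^ i))).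
    * assert (0 < 2 ^ i) by (apply pow_lt; lra). simpl (INR 5). nra.
    * replace (2 * 2 ^ i) with (/ dyadic i)
        by (apply Rmult_eq_reg_r with (dyadic i); [rewrite Rinv_l|]; lra).
      unfold mu; field; lra.
- apply in_seq; split; [lia|]. apply INR_lt. rewrite Nat.add_0_l, plus_INR. simpl (INR 1).
  apply Rle_lt_trans with (INR A); [|lra].
  eapply Rle_trans; [apply Hq|].
  apply Rmult_le_reg_r with mu; [easy|].
  unfold Rdiv at 1; rewrite Rmult_assoc, Rinv_l by lra.
  unfold mu; replace (INR A * (dyadic i / INR A)) with (dyadic i) by (field; lra). lra.
Qed.

(** The denominator of the pseudohyperbolic distance is at least [1 - |z k|], because
    [|z l| < 1]. *)
Lemma separated_spacing (z : nat -> C) :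
  (forall k, in_disc (z k)) -> separated z ->
  exists delta, 0 < delta /\ forall k l, k <> l ->
    delta * (1 - Cmod (z k)) <= Cmod (z k - z l).
Proof.
intros Hd Hs. unfold separated in Hs.
set (E := fun d => _) in Hs.
assert (HE := proj1 (Glb_Rbar_correct E)).
assert (K : exists delta, 0 < delta /\ forall d, E d -> delta <= d).
{ destruct (Glb_Rbar E) as [g| |]; [|exists 1; split; [lra|]|easy].
  - exists g; split; [easy|]. intros d Hd'; exact (HE d Hd').
  - intros d Hd'; destruct (HE d Hd'). }
destruct K as (delta & d0 & Hdelta). exists delta; split; [easy|].
intros k l Hkl.
specialize (Hdelta _ (ex_intro _ k (ex_intro _ l (conj Hkl eq_refl)))).
assert (N := one_minus_conj_mult_neq_0 (z k) (z l) (Hd k) (Hd l)).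
unfold pseudo_hyp_dist in Hdelta. rewrite Cmod_div in Hdelta by exact N.
apply Cmod_gt_0 in N.
assert (L : 1 - Cmod (z k) <= Cmod (RtoC 1 - Cconj (z k) * z l)).
{ eapply Rle_trans; [|apply Cmod_triangle_inv].
  rewrite Cmod_1, Cmod_mult, Cmod_conj.
  assert (Hk := Hd k). assert (Hl := Hd l). unfold in_disc in *.
  pose proof (Cmod_ge_0 (z k)). nra. }
apply Rle_trans with (delta * Cmod (RtoC 1 - Cconj (z k) * z l)).
- apply Rmult_le_compat_l; lra.
- apply Rmult_le_reg_r with (/ Cmod (RtoC 1 - Cconj (z k) * z l)).
  + now apply Rinv_0_lt_compat.
  + rewrite Rmult_assoc, Rinv_r by lra. rewrite Rmult_1_r. exact Hdelta.
Qed.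

(** The condition [14 < delta * A] makes cells too small for two points. Level [i] has
    [20 * A * (A + 1) * 2 ^ i] cells, and by monotonicity a point in one of them costs at most
    [rho theta (dyadic i)]. *)
Lemma Rsum_separated_le (theta : R -> R) (z : nat -> C) (delta : R) (A : nat) (m n K : nat) :
  (forall s t : R, 0 < s -> s <= t -> t < 1 -> rho theta s <= rho theta t) ->
  0 < delta -> 14 < delta * INR A ->
  (forall k, in_disc (z k)) ->
  (forall k l, k <> l -> delta * (1 - Cmod (z k)) <= Cmod (z k - z l)) ->
  (forall k, (k < K)%nat -> dyadic (m + n) < 1 - Cmod (z k) <= dyadic m) ->
  Rsum (fun k => rho theta (1 - Cmod (z k))) K
    <= INR (20 * A * (A + 1)) * Rsum (fun i => 2 ^ (m + i) * rho theta (dyadic (m + i))) n.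
Proof.
intros Hm d0 HA Hd Hsep Hz.
assert (A0 : (0 < A)%nat).
{ destruct A as [|A]; [simpl in HA; lra|lia]. }
assert (A1 : 0 < INR A) by now apply lt_0_INR.
set (w := fun c : cell => rho theta (dyadic (fst c))).
set (cells := flat_map (level_cells A) (seq m n)).
assert (T : list_sum w cells =
  INR (20 * A * (A + 1)) * Rsum (fun i => 2 ^ (m + i) * rho theta (dyadic (m + i))) n).
{ unfold cells. clear Hz. induction n as [|n IH]; [simpl; ring|].
  rewrite seq_S, flat_map_app, list_sum_app, IH. simpl flat_map. rewrite app_nil_r.
  rewrite (list_sum_const w (rho theta (dyadic (m + n)))).
  - rewrite level_cells_length, (mult_INR _ (2 ^ (m + n))), INR_pow2. simpl Rsum. ring.
  - intros c Hc. apply in_map_iff in Hc. destruct Hc as (x & <- & _). easy. }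
rewrite <- T.
apply (Rsum_le_list_sum _ w (fun k c => in_cell A (z k) c)).
- intros c; left; apply rho_pos, dyadic_bounds.
- intros k l c Hk Hl. destruct (Nat.eq_dec k l) as [|N]; [easy|exfalso].
  assert (C := in_cell_close A _ _ c A0 Hk Hl). specialize (Hsep k l N).
  assert (Hk' := Hd k). unfold in_disc in Hk'.
  assert (14 / INR A < delta).
  { apply Rmult_lt_reg_r with (INR A); [easy|]. unfold Rdiv; rewrite Rmult_assoc, Rinv_l; lra. }
  nra.
- intros k Hk. destruct (Hz k Hk) as [z1 z2].
  destruct (dyadic_level_exists _ _ _ z1 z2) as (i & Hi & Hx).
  destruct (in_cell_exists A (z k) i A0 Hx) as (c & Hc & Ic).
  exists c; split; [easy|]; split.
  + apply in_flat_map. exists i; split; [apply in_seq; lia|easy].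
  + apply in_map_iff in Ic. destruct Ic as (x & <- & _). unfold w; simpl.
    pose proof (dyadic_bounds i). pose proof (dyadic_bounds (S i)).
    apply Hm; lra.
Qed.

(** * Convergence when the integral is finite *)

Lemma Rsum_bounded_ex_series (F : nat -> R) (B : R) :
  (forall k, 0 <= F k) -> (forall n, Rsum F n <= B) -> ex_series F.
Proof.
intros HF HB.
destruct (ex_finite_lim_seq_incr (sum_n F) B) as [l Hl].
- intros n; rewrite !sum_n_Rsum. simpl; specialize (HF (S n)); lra.
- intros n; rewrite sum_n_Rsum; apply HB.
- now exists l.
Qed.

(** The integrand is positive, so the integral over [[d, eps]] grows as [d] decreases. Unboundedness
    for every [eps] in [(0, 1)] would therefore already be divergence to infinity. *)
Lemma not_infinite_integral_bounded (theta : R -> R) :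
  (forall t : R, 0 < t < 1 -> continuous (rho theta) t) ->
  ~ int_at_0_infinite (fun t : R => rho theta t / t ^ 2) ->
  exists eps B, 0 < eps < 1 /\ forall d, 0 < d <= eps ->
    RInt (fun t => rho theta t / t ^ 2) d eps <= B.
Proof.
intros Hc Hn. apply NNPP; intros H. apply Hn.
exists 1; split; [lra|]. intros eps He P [B HB].
assert (K : exists d, 0 < d <= eps /\ B < RInt (fun t => rho theta t / t ^ 2) d eps).
{ apply NNPP; intros H'. apply H. exists eps, B; split; [easy|].
  intros d Hd. apply Rnot_lt_le; intros L. apply H'. now exists d. }
destruct K as (d & Hd & HdB).
exists (mkposreal d (proj1 Hd)). intros y Hy y0. apply HB.
unfold ball in Hy; simpl in Hy; unfold AbsRing_ball, abs, minus, plus, opp in Hy; simpl in Hy.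
rewrite Rabs_right in Hy by lra.
rewrite (weight_RInt_Chasles theta Hc y d eps) by lra.
assert (0 <= RInt (fun t => rho theta t / t ^ 2) y d); [|lra].
apply RInt_ge_0; [lra|apply weight_ex_RInt; trivial; lra|].
intros t Ht. left. apply Rdiv_lt_0_compat; [apply rho_pos; lra|apply pow_lt; lra].
Qed.

Lemma separated_thin (theta : R -> R) (z : nat -> C) :
  (forall t : R, 0 < t < 1 -> continuous (rho theta) t) ->
  (forall s t : R, 0 < s -> s <= t -> t < 1 -> rho theta s <= rho theta t) ->
  ~ int_at_0_infinite (fun t : R => rho theta t / t ^ 2) ->
  disc_seq z -> separated z -> thin theta z.
Proof.
intros Hc Hm Hni [Hd Hlim] Hs.
destruct (not_infinite_integral_bounded theta Hc Hni) as (eps & B & Heps & HB).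
destruct (separated_spacing z Hd Hs) as (delta & d0 & Hdelta).
destruct (dyadic_small eps (proj1 Heps)) as [m' Hm'].
(* The lower half of [weight_dyadic_sum] evaluates [rho] one level further than its power of 2. The
   shift realigns them at the cost of a factor 2. *)
set (m := S m').
assert (HS : forall n, Rsum (fun i => 2 ^ (m + i) * rho theta (dyadic (m + i))) n <= 2 * B).
{ intros n.
  rewrite (Rsum_ext _ (fun i => 2 * (2 ^ (m' + i) * rho theta (dyadic (S (m' + i))))))
    by (intros i _; unfold m; simpl; ring).
  rewrite Rsum_scal_l. apply Rmult_le_compat_l; [lra|].
  eapply Rle_trans; [apply (weight_dyadic_sum theta Hc Hm)|].
  pose proof (dyadic_bounds (m' + n)). assert (L : dyadic (m' + n) <= dyadic m') by (apply dyadic_le; lia).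
  eapply Rle_trans; [|apply (HB (dyadic (m' + n))); lra].
  rewrite (weight_RInt_Chasles theta Hc (dyadic (m' + n)) (dyadic m') eps) by lra.
  assert (0 <= RInt (fun t => rho theta t / t ^ 2) (dyadic m') eps); [|lra].
  pose proof (dyadic_bounds m').
  apply RInt_ge_0; [lra|apply weight_ex_RInt; trivial; lra|].
  intros t Ht. left. apply Rdiv_lt_0_compat; [apply rho_pos; lra|apply pow_lt; lra]. }
apply is_lim_seq_spec in Hlim.
(* Only finitely many points lie farther than [dyadic m] from the circle; the series is studied from
   [K0] on. *)
destruct (Hlim (mkposreal _ (proj1 (dyadic_bounds m)))) as [K0 HK0]. simpl in HK0.
assert (near : forall k, 0 < 1 - Cmod (z (K0 + k)%nat) <= dyadic m).
{ intros k. assert (H := HK0 (K0 + k)%nat ltac:(lia)). assert (H' := Hd (K0 + k)%nat).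
  unfold in_disc in H'. rewrite Rabs_left in H by lra. lra. }
exists (fun _ => RtoC 1). split; [|split].
- split.
  + intros w _. apply ex_derive_const.
  + exists 1; intros w _. rewrite Cmod_1; lra.
- exists (RtoC 0). split; [unfold in_disc; rewrite Cmod_0; lra|].
  intros H; apply RtoC_inj in H; lra.
- apply (ex_series_incr_n _ K0).
  destruct (nfloor_ex (14 / delta)) as [A HA].
  { apply Rmult_le_pos; [lra|]. left; now apply Rinv_0_lt_compat. }
  assert (HA' : 14 < delta * INR (S A)).
  { rewrite S_INR. replace 14 with (delta * (14 / delta)) by (field; lra).
    apply Rmult_lt_compat_l; lra. }
  apply (Rsum_bounded_ex_series _ (INR (20 * S A * (S A + 1)) * (2 * B))).
  + intros k. destruct (Ceq_dec _ _); [lra|]. rewrite Cmod_1, Rmult_1_r.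
    left; apply rho_pos. apply near.
  + intros K.
    (* Finitely many points meet finitely many levels. The number [n] depends on [K], but the final
       bound does not. *)
    assert (low : exists n, forall k, (k < K)%nat -> dyadic (m + n) < 1 - Cmod (z (K0 + k)%nat)).
    { clear - near. induction K as [|K [n IH]]; [exists O; lia|].
      destruct (dyadic_small (1 - Cmod (z (K0 + K)%nat))) as [n' Hn']; [apply near|].
      exists (n + n')%nat; intros k Hk.
      destruct (Nat.eq_dec k K) as [->|N].
      - eapply Rle_lt_trans; [|exact Hn']. apply dyadic_le; lia.
      - eapply Rle_lt_trans; [|apply IH; lia]. apply dyadic_le; lia. }
    destruct low as [n low].
    apply Rle_trans with (Rsum (fun k => rho theta (1 - Cmod (z (K0 + k)%nat))) K).
    * apply Rsum_le; intros k _. rewrite Cmod_1, Rmult_1_r.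
      destruct (Ceq_dec _ _); [|lra]. left; apply rho_pos, near.
    * eapply Rle_trans.
      -- apply (Rsum_separated_le theta (fun k => z (K0 + k)%nat) delta (S A) m n K Hm d0 HA').
         ++ intros k; apply Hd.
         ++ intros k l Hkl; apply Hdelta; lia.
         ++ intros k Hk; split; [now apply low|apply near].
      -- apply Rmult_le_compat_l; [apply pos_INR|apply HS].
Qed.

Theorem proposition1p5 :
  forall theta : R -> R,
    (forall t : R, 0 < t < 1 -> continuous (rho theta) t) ->
    (forall s t : R, 0 < s -> s <= t -> t < 1 -> rho theta s <= rho theta t) ->
    (exists c : R, 0 < c /\ forall t : R, 0 < t < 1 -> rho theta t <= c * t) ->
    ((exists z : nat -> C, disc_seq z /\ separated z /\ thick theta z) <->
     int_at_0_infinite (fun t : R => rho theta t / t ^ 2)).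
Proof.
intros theta Hc Hm _; split.
- intros (z & Hz & Hsep & Hthick).
  apply NNPP; intros Hni. apply Hthick.
  now apply separated_thin.
- intros Hint. exists lattice. split; [apply lattice_disc_seq|].
  split; [apply lattice_separated|now apply lattice_thick].
Qed.
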